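(* Let \[ K = \{ (x,y,0)^T \mid x \leq 0,\ y \geq 0 \} \cup \left\{ (x,y,z)^T \,\left|\, \frac{y}{z} \geq \exp\frac{x}{z},\ z > 0 \right. \right\} \subset \mathbb R^3 \] be the homogenization of the epigraph of the exponential function, and let $F$ be the canonical potential of $K$. Then the level set $\{F = 0\}$, which is a complete hyperbolic affine sphere asymptotic to $\partial K$, is given by the hypersurface immersion \[ (0,\infty)^2 \ni \begin{pmatrix} \kappa \\ z \end{pmatrix} \mapsto \begin{pmatrix} x \\ y \\ z \end{pmatrix} = \begin{pmatrix} -z\left(3\log z + \frac32\log\kappa + \kappa\right) \\ z^{-2}\kappa^{-3/2}\sqrt{1+\kappa} \\ z \end{pmatrix}. \]
   Context: A convex cone in $\mathbb R^n$ is regular if it is closed, has non-empty interior, and contains no line. The canonical potential of a regular convex cone $K\subset\mathbb R^n$ is the unique smooth solution $F: K^o \to \mathbb R$ ($K^o$ the interior of $K$) of the Monge-Ampère problem $\det F'' = e^{2F}$, $F|_{\partial K} = +\infty$, $F'' \succ 0$, where $F''$ is the Hessian in the standard coordinates and the boundary condition means that $F(x) \to +\infty$ as $x$ tends to a boundary point of $K$. It is known that this solution exists and is unique, and that the complete hyperbolic affine spheres asymptotic to the boundary of $K$ (in the sense of equiaffine differential geometry: convex hypersurfaces whose affine normals all meet at the vertex of $K$, which separate their convex hull from that point, and which are complete in the affine metric) are exactly the level sets of $F$; they are related to each other by homotheties.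
   Formalization: The canonical potential is taken to be the logarithmically homogeneous solution, F(tx) = F(x) − n ln t, since the boundary value problem alone has several solutions (on the half-line, both −ln x and −ln sinh x). *)

(* Defs.v *)
From HB Require Import structures.
From mathcomp Require Import all_boot all_order all_algebra.
From mathcomp Require Import all_classical all_reals all_analysis.

Set Implicit Arguments.
Unset Strict Implicit.
Unset Printing Implicit Defensive.

Import Order.TTheory GRing.Theory Num.Theory.
Import numFieldNormedType.Exports.

Local Open Scope classical_set_scope.
Local Open Scope ring_scope.

Definition regular_cone (R : realType) (n : nat) (K : set 'cV[R]_n) : Prop :=
  [/\ forall (a b : R) (x y : 'cV[R]_n),
        0 <= a -> 0 <= b -> K x -> K y -> K (a *: x + b *: y),
      closed K,
      K° !=set0
    & ~ exists p v : 'cV[R]_n, v != 0 /\ forall t : R, K (p + t *: v)].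

Definition partial (R : realType) (m : nat) (W : normedModType R)
    (i : 'I_m) (f : 'cV[R]_m -> W) : 'cV[R]_m -> W :=
  fun p => 'D_(delta_mx i 0 : 'cV[R]_m) f p.

(* C^oo: iterated partial derivatives of every order exist and are continuous
   on U.  Only meant for open U. *)
Definition smooth_on (R : realType) (m : nat) (W : normedModType R)
    (U : set 'cV[R]_m) (f : 'cV[R]_m -> W) : Prop :=
  forall (s : seq 'I_m) (p : 'cV[R]_m), U p ->
    let g := foldr (fun i => @partial R m W i) f s in
    {for p, continuous g} /\
    forall i : 'I_m, derivable g p (delta_mx i 0 : 'cV[R]_m).

Definition posdef (R : realType) (m : nat) (A : 'M[R]_m) : Prop :=
  A^T = A /\ forall v : 'cV[R]_m, v != 0 -> 0 < (v^T *m A *m v) 0 0.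

Definition hessian (R : realType) (n : nat) (F : 'cV[R]_n -> R)
    (x : 'cV[R]_n) : 'M[R]_n :=
  \matrix_(i, j) partial i (partial j (F : 'cV[R]_n -> R^o)) x.

Definition monge_ampere_solution (R : realType) (n : nat)
    (K : set 'cV[R]_n) (F : 'cV[R]_n -> R) : Prop :=
  [/\ smooth_on K° (F : 'cV[R]_n -> R^o),
      forall x, K° x -> posdef (hessian F x),
      forall x, K° x -> \det (hessian F x) = expR (2 * F x)
    & forall p, closure K p -> ~ K° p ->
        F x @[x --> within K° (nbhs p)] --> +oo].

(* The boundary value problem alone does not determine F: on the half-line
   both - ln x and - ln (sinh x) solve it.  The canonical potential is the
   solution that is logarithmically homogeneous, equivalently (by Cheng-Yau)
   the one whose Hessian metric is complete; its level sets are exchanged by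
   the homotheties x |-> t *: x. *)
Definition canonical_potential (R : realType) (n : nat)
    (K : set 'cV[R]_n) (F : 'cV[R]_n -> R) : Prop :=
  [/\ regular_cone K,
      monge_ampere_solution K F
    & forall (t : R) (x : 'cV[R]_n), 0 < t -> K° x ->
        F (t *: x) = F x - n%:R * ln t].

(* F carries no information outside the interior of K. *)
Definition level_set (R : realType) (n : nat) (K : set 'cV[R]_n)
    (F : 'cV[R]_n -> R) (c : R) : set 'cV[R]_n :=
  [set x | K° x /\ F x = c].

Definition immersion_on (R : realType) (m n : nat) (U : set 'cV[R]_m)
    (f : 'cV[R]_m -> 'cV[R]_n) : Prop :=
  smooth_on U f /\
  forall p, U p -> injective ('d f p : 'cV[R]_m -> 'cV[R]_n).

Definition jacobian (R : realType) (m n : nat) (f : 'cV[R]_m -> 'cV[R]_n)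
    (p : 'cV[R]_m) : 'M[R]_(n, m) :=
  \matrix_(i, j) partial j f p i 0.

Definition tangent_space (R : realType) (m n : nat)
    (f : 'cV[R]_m -> 'cV[R]_n) (p : 'cV[R]_m) : set 'cV[R]_n :=
  range (mulmx (jacobian f p) : 'cV[R]_m -> 'cV[R]_n).

(* xi is the equiaffine normal and h the affine (Blaschke) metric of a locally
   strongly convex immersed hypersurface f.  In order: the Gauss formula
   d_i d_j f = tangential + h_ij xi; d_i xi is tangential; the volume form
   det(xi, d_1 f, .., d_m f) induced by xi is that of h.  Requiring h to be
   positive definite fixes the sign of xi. *)
Definition blaschke_normal (R : realType) (m : nat) (U : set 'cV[R]_m)
    (f xi : 'cV[R]_m -> 'cV[R]_(1 + m)) (h : 'cV[R]_m -> 'M[R]_m) : Prop :=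
  smooth_on U xi /\
  forall p, U p ->
    [/\ posdef (h p),
        forall i j,
          tangent_space f p (partial i (partial j f) p - h p i j *: xi p),
        forall i, tangent_space f p (partial i xi p)
      & \det (row_mx (xi p) (jacobian f p)) ^+ 2 = \det (h p)].

Definition C1_path (R : realType) (m : nat) (U : set 'cV[R]_m)
    (p q : 'cV[R]_m) (c : R -> 'cV[R]_m) : Prop :=
  [/\ forall t, derivable c t 1,
      continuous (derive1 c),
      forall t, 0 <= t <= 1 -> U (c t),
      c 0 = p
    & c 1 = q].

Definition path_length (R : realType) (m : nat) (h : 'cV[R]_m -> 'M[R]_m)
    (c : R -> 'cV[R]_m) : \bar R :=
  (\int[lebesgue_measure]_(t in `[0%R, 1%R])
    (Num.sqrt (((derive1 c t)^T *m h (c t) *m derive1 c t) 0 0))%:E)%E.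

Definition metric_dist (R : realType) (m : nat) (U : set 'cV[R]_m)
    (h : 'cV[R]_m -> 'M[R]_m) (p q : 'cV[R]_m) : \bar R :=
  ereal_inf [set path_length h c | c in C1_path U p q].

Definition complete_metric (R : realType) (m : nat) (U : set 'cV[R]_m)
    (h : 'cV[R]_m -> 'M[R]_m) : Prop :=
  forall u : nat -> 'cV[R]_m,
    (forall k, U (u k)) ->
    (forall eps : R, 0 < eps -> exists N : nat, forall k l : nat,
       (N <= k)%N -> (N <= l)%N ->
       (metric_dist U h (u k) (u l) < eps%:E)%E) ->
    exists2 p, U p & metric_dist U h (u k) p @[k --> \oo] --> 0%E.

Definition conv_hull (R : realType) (n : nat) (S : set 'cV[R]_n)
    : set 'cV[R]_n :=
  smallest (@convex_set R 'cV[R]_n) S.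

Definition separates (R : realType) (n : nat) (S A : set 'cV[R]_n)
    (p : 'cV[R]_n) : Prop :=
  ~ S p /\
  forall C : set 'cV[R]_n,
    connected C -> C p -> C `&` A !=set0 -> C `&` S !=set0.

Definition asymptotic_to_boundary (R : realType) (n : nat)
    (K S : set 'cV[R]_n) : Prop :=
  S `<=` K° /\
  forall eps : R, 0 < eps -> exists M : R, forall x, S x -> M < `|x| ->
    exists q, [/\ closure K q, ~ K° q & `|x - q| < eps].

(* Complete hyperbolic affine sphere with centre 0 (the vertex of K),
   asymptotic to the boundary of K.  Such a hypersurface is diffeomorphic to
   R^m, so it is presented by one global chart f. *)
Definition complete_hyperbolic_affine_sphere (R : realType) (m : nat)
    (K S : set 'cV[R]_(1 + m)) : Prop :=
  exists (U : set 'cV[R]_m) (f xi : 'cV[R]_m -> 'cV[R]_(1 + m))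
         (h : 'cV[R]_m -> 'M[R]_m),
    [/\ [/\ open U, connected U & U !=set0],
        [/\ immersion_on U f, {in U &, injective f} & f @` U = S],
        [/\ blaschke_normal U f xi h,
            forall p, U p -> exists t : R, f p + t *: xi p = 0
          & complete_metric U h]
      & [/\ S `&` (conv_hull S)° = set0,
            separates S (conv_hull S) 0
          & asymptotic_to_boundary K S]].

Definition vec2 (R : realType) (a b : R) : 'cV[R]_2 :=
  \col_i [:: a; b]`_i.

Definition vec3 (R : realType) (x y z : R) : 'cV[R]_3 :=
  \col_i [:: x; y; z]`_i.

Definition exp_cone (R : realType) : set 'cV[R]_3 :=
  [set v | exists x y, [/\ v = vec3 x y 0, x <= 0 & 0 <= y]] `|`
  [set v | exists x y z,
     [/\ v = vec3 x y z, expR (x / z) <= y / z & 0 < z]].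

Definition quadrant (R : realType) : set 'cV[R]_2 :=
  [set p | exists kappa z, [/\ p = vec2 kappa z, 0 < kappa & 0 < z]].

Definition sphere_param (R : realType) (p : 'cV[R]_2) : 'cV[R]_3 :=
  let kappa := p 0 0 in
  let z := p 1 0 in
  vec3 (- z * (3 * ln z + 3 / 2 * ln kappa + kappa))
       (z ^- 2 * kappa `^ (- (3 / 2)) * Num.sqrt (1 + kappa))
       z.

(* Main.v *)
(* The symmetries (x, y, z) |-> (a x + b z, a exp(b / a) y, a z) of K reduce the
   Monge-Ampere equation to an ODE: put u = ln (y / z) - x / z, the height of a
   point above the graph of exp, and seek F = - ln y - 2 ln z + phi(u). Writing
   phi' = - 1 / kappa, the equation becomes u = kappa + ln (1 + kappa) / 2 =:
   theta(kappa), and F = 0 turns into y^2 z^4 kappa^3 = 1 + kappa, which is the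
   stated parametrization.
   Uniqueness is a maximum principle. For two potentials F and G let A = 1 +
   lam e l with e interior to K and l positive on K \ {0}. Then A pushes K \ {0}
   into the interior of K, so F o A - G attains a maximum; comparing Hessians
   there bounds it by - ln det A, and lam -> 0 gives F <= G.
   The affine normal of the level set is proportional to the position vector,
   and the affine metric is diagonal in (ln kappa, ln (z sqrt kappa)) and
   dominates a multiple of the Euclidean metric, hence is complete. *)
Require Import Defs.
From HB Require Import structures.
From mathcomp Require Import all_boot all_order all_algebra.
From mathcomp Require Import all_classical all_reals all_analysis.
From mathcomp Require Import measurable_realfun.
From mathcomp Require Import ring lra.

Import Order.TTheory GRing.Theory Num.Theory.
Import numFieldNormedType.Exports.

Local Open Scope classical_set_scope.
Local Open Scope ring_scope.

Set Implicit Arguments.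
Unset Strict Implicit.
Unset Printing Implicit Defensive.

(** * Differential calculus on column vectors *)

(** With k for kappa, the ansatz turns the determinant equation into phi'' (2 + 3 / k) - (1 + k) /
    k^3 = exp (2 phi). The relation exp (2 phi) = (1 + k) / k^3 solves it: differentiated together
    with phi' = - 1 / k it gives k' = 2 (1 + k) / (2 k + 3), hence phi'' = k' / k^2, and both sides
    agree. Integrating 1 / k' from k = 0 yields theta; the constant is fixed by phi -> +oo at u = 0.
    Comparing F with G directly is hopeless at the boundary, where both are infinite. F o A stays
    finite there, so the gap F o A - G is -oo at every boundary point other than 0. The convex hull
    of the sphere is controlled through the sublevel set F <= 0, which is convex, closed and misses
    the vertex. Asymptoticity is proved by contraposition: the points of the sphere that keep a
    fixed distance from the boundary of K form a bounded set. *)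

Section directional_derivatives.
Context {R : realType}.

(** This transfers the one-variable chain rule and mean value theorem to directional derivatives. *)
Lemma is_derive_lineE (V W : normedModType R) (f : V -> W) (p v : V) (d : W) :
  is_derive p v f d <-> is_derive (0 : R) 1 (fun h : R => f (h *: v + p)) d.
Proof.
have E : (fun h : R => h^-1 *: ((f \o shift p) (h *: v) - f p)) =
    (fun h : R => h^-1 *: (((fun h : R => f (h *: v + p)) \o shift 0) h%:A - f (0 *: v + p))).
  by apply/funext => h /=; rewrite addr0 scale0r add0r [_%:A]mulr1.
split=> -[]; rewrite /derivable /derive => c l; apply: DeriveDef;
  rewrite /derivable /derive.
- by rewrite -E.
- by rewrite -E.
- by rewrite E.
- by rewrite E.
Qed.

Lemma is_derive_line_at (V W : normedModType R) (f : V -> W) (p v : V) (t : R)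
    (d : W) :
  is_derive (t *: v + p) v f d -> is_derive t 1 (fun h : R => f (h *: v + p)) d.
Proof.
move/is_derive_lineE => H; apply/is_derive_lineE.
by congr (is_derive _ _ _ _): H; apply/funext => h; rewrite [h%:A]mulr1 scalerDl addrA.
Qed.

Lemma is_derive_comp_real (V : normedModType R) (f : V -> R) (g : R -> R)
    (p v : V) (df dg : R) :
  is_derive p v f df -> is_derive (f p) 1 g dg ->
  is_derive p v (fun x => g (f x)) (df * dg).
Proof.
move/is_derive_lineE => Hf Hg; apply/is_derive_lineE.
have Hg' : is_derive ((fun h : R => f (h *: v + p)) 0) (1 : R) g dg.
  by rewrite scale0r add0r.
rewrite mulrC; exact: (is_derive1_comp Hg' Hf).
Qed.

Lemma is_derive_real_continuous (g : R -> R) (x d : R) :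
  is_derive x 1 g d -> {for x, continuous g}.
Proof. by case=> dg _; apply/differentiable_continuous/derivable1_diffP. Qed.

(** Increments s of either sign occur when coordinates are telescoped, so the intermediate point is
    located only by its absolute value. *)
Lemma mean_value_along (V : normedModType R) (f df : V -> R) (q e : V) (s : R) :
  (forall r : R, `|r| <= `|s| -> is_derive (r *: e + q) e f (df (r *: e + q))) ->
  exists2 r : R, `|r| <= `|s| &
    f (s *: e + q) - f q = s * df (r *: e + q).
Proof.
move=> H.
pose g (r : R) := f (r *: e + q); pose dg (r : R) := df (r *: e + q).
have dgP (r : R) : `|r| <= `|s| -> is_derive r 1 g (dg r).
  by move=> rs; apply: is_derive_line_at; exact: H.
have g0 : g 0 = f q by rewrite /g scale0r add0r.
have [s0|s0] := leP 0 s.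
  have H1 (r : R) : r \in `]0, s[%R -> is_derive r 1 g (dg r).
    rewrite in_itv/= => /andP[r0 rs]; apply: dgP.
    by rewrite !ger0_norm// ltW.
  have H2 : {within `[0, s], continuous g}.
    apply: derivable_within_continuous => r; rewrite in_itv/= => /andP[r0 rs].
    by have [] : is_derive r 1 g (dg r) by apply: dgP; rewrite !ger0_norm.
  have [c cs E] := MVT_segment s0 H1 H2.
  exists c; first by move: cs; rewrite in_itv/= => /andP[? ?]; rewrite !ger0_norm.
  by move: E; rewrite g0 subr0 mulrC.
have H1 (r : R) : r \in `]s, 0[%R -> is_derive r 1 g (dg r).
  rewrite in_itv/= => /andP[r0 rs]; apply: dgP.
  by rewrite !ltr0_norm// lerN2 ltW.
have H2 : {within `[s, 0], continuous g}.
  apply: derivable_within_continuous => r; rewrite in_itv/= => /andP[r0 rs].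
  by have [] : is_derive r 1 g (dg r)
    by apply: dgP; rewrite (ler0_norm rs) (ltr0_norm s0) lerN2.
have [c cs E] := MVT_segment (ltW s0) H1 H2.
exists c.
  move: cs; rewrite in_itv/= => /andP[? rs].
  by rewrite (ler0_norm rs) (ltr0_norm s0) lerN2.
move: E; rewrite g0 sub0r mulrN => E; rewrite -[f _]/(g s).
by apply/eqP; rewrite -eqr_opp opprB E mulrC.
Qed.

Lemma is_diff_expansion (V W : normedModType R) (f : V -> W) (p : V)
    (l : {linear V -> W}) : continuous l ->
  (forall e : R, 0 < e -> exists2 d : R, 0 < d & forall h, `|h| < d ->
    `|f (h + p) - f p - l h| <= e * `|h|) ->
  is_diff p f l.
Proof.
move=> lc H.
have E : f \o shift p = cst (f p) + l +o_ 0 id.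
  apply/eqaddoP => e e0; have [d d0 Hd] := H e e0.
  near=> h; rewrite /= -[X in `|X|]/(f (h + p) - (f p + l h)) opprD addrA.
  by apply: Hd; near: h; exact: nbhs0_lt.
have D : 'd f p = l :> (_ -> _) by exact: diff_unique.
by apply: DiffDef => //; apply/diff_locallyP; rewrite D.
Unshelve. all: by end_near. Qed.

End directional_derivatives.

(* The derivation rules of the library in lambda form, so that they apply to
   functions of a vector given by an explicit expression. *)
Section derivation_rules.
Context {R : realType} {V : normedModType R}.
Implicit Types (f g : V -> R) (p v : V) (df dg : R).

Lemma dir_cst p v (c : R) : is_derive p v (fun=> c) 0.
Proof. exact: is_derive_cst. Qed.

Lemma dir_D f g p v df dg : is_derive p v f df -> is_derive p v g dg ->
  is_derive p v (fun x => f x + g x) (df + dg).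
Proof. by move=> Hf Hg; exact: (@is_deriveD R V R^o f g). Qed.

Lemma dir_N f p v df : is_derive p v f df ->
  is_derive p v (fun x => - f x) (- df).
Proof. by move=> Hf; exact: (@is_deriveN R V R^o f). Qed.

Lemma dir_B f g p v df dg : is_derive p v f df -> is_derive p v g dg ->
  is_derive p v (fun x => f x - g x) (df - dg).
Proof. by move=> Hf Hg; apply: dir_D => //; exact: dir_N. Qed.

Lemma dir_M f g p v df dg : is_derive p v f df -> is_derive p v g dg ->
  is_derive p v (fun x => f x * g x) (f p * dg + g p * df).
Proof. by move=> Hf Hg; exact: (@is_deriveM R V f g). Qed.

Lemma dir_V f p v df : f p != 0 -> is_derive p v f df ->
  is_derive p v (fun x => (f x)^-1) (- (df / f p ^+ 2)).
Proof.
move=> f0 Hf.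
have H : is_derive (f p : R) 1 (fun x : R => x^-1) (- (f p) ^- 2 *: (1 : R)).
  exact: is_deriveV.
by apply: (is_derive_eq (is_derive_comp_real Hf H)); rewrite /GRing.scale/=; ring.
Qed.

Lemma dir_ln f p v df : 0 < f p -> is_derive p v f df ->
  is_derive p v (fun x => ln (f x)) (df / f p).
Proof. by move=> f0 Hf; apply: is_derive_comp_real Hf _; exact: is_derive1_ln. Qed.

Lemma dir_expR f p v df : is_derive p v f df ->
  is_derive p v (fun x => expR (f x)) (df * expR (f p)).
Proof. by move=> Hf; apply: is_derive_comp_real Hf _; exact: is_derive_expR. Qed.

Lemma dir_sqrt f p v df : 0 < f p -> is_derive p v f df ->
  is_derive p v (fun x => Num.sqrt (f x)) (df / (2 * Num.sqrt (f p))).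
Proof. by move=> f0 Hf; apply: is_derive_comp_real Hf _; exact: is_derive1_sqrt. Qed.

End derivation_rules.

(** * Functions of class C^k on an open set *)

Section Ck.
Context {R : realType} {m : nat}.
Implicit Types (U : set 'cV[R]_m) (f g : 'cV[R]_m -> R^o).

Local Notation evec i := (delta_mx i 0 : 'cV[R]_m).

(** [smooth_on] quantifies over lists of partial derivatives. Recursion on the order instead lets
    closure under sums, products and compositions be proved by induction on k. *)
Fixpoint Ck U (k : nat) f : Prop :=
  (forall p, U p -> {for p, continuous f}) /\
  if k is k'.+1 then
    (forall p i, U p -> derivable f p (evec i)) /\ (forall i, Ck U k' (partial i f))
  else True.

Lemma Ck_continuous U k f p : Ck U k f -> U p -> {for p, continuous f}.
Proof. by case: k => [|k] [H _]; exact: H. Qed.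

Lemma Ck_is_derive U k f p i : Ck U k.+1 f -> U p ->
  is_derive p (evec i) f (partial i f p).
Proof. by case=> _ [H _] Up; apply: derivableP; exact: H. Qed.

Lemma CkW U k f : Ck U k.+1 f -> Ck U k f.
Proof.
elim: k f => [|k IH] f; first by case.
case=> c [d H]; split=> //; split=> // i; exact/IH/H.
Qed.

Lemma smooth_onP U f : smooth_on U f <-> forall k, Ck U k f.
Proof.
split=> [H k|H s p Up].
  suff: forall s, Ck U k (foldr (fun i => @partial R m R^o i) f s).
    by move/(_ [::]).
  elim: k => [|k IH] s; (split; first by move=> p Up; exact: (H s p Up).1) => //.
  split; first by move=> p i Up; exact: (H s p Up).2.
  by move=> i; exact: (IH (i :: s)).
have {}H k : Ck U k (foldr (fun i => @partial R m R^o i) f s).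
  elim: s k => [|i s IH] k; first exact: H.
  by have [_ [_]] := IH k.+1; exact.
split; first exact: Ck_continuous (H 0) Up.
by move=> i; have [_ [+ _]] := H 1; exact.
Qed.

Lemma Ck_partial U k f i : Ck U k.+1 f -> Ck U k (partial i f).
Proof. by case=> _ [_]; exact. Qed.

Lemma near_open U p (P : 'cV[R]_m -> Prop) : open U -> U p ->
  (forall q, U q -> P q) -> \forall q \near p, P q.
Proof.
move=> oU Up UP; have : nbhs p U by exact: open_nbhs_nbhs.
by apply: filterS => q; exact: UP.
Qed.

Lemma eq_on_open_partial U f g i : open U -> (forall p, U p -> f p = g p) ->
  forall p, U p -> partial i f p = partial i g p.
Proof.
move=> oU fg p Up; by apply: near_eq_derive; exact: near_open fg.
Qed.

Lemma eq_Ck U k f g : open U -> (forall p, U p -> f p = g p) ->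
  Ck U k f -> Ck U k g.
Proof.
move=> oU; elim: k f g => [|k IH] f g fg /= [cf H].
  split=> // p Up; have := cf p Up; rewrite /prop_for /continuous_at -fg//.
  by apply: cvg_trans (near_eq_cvg (near_open oU Up _)) => q Uq; rewrite fg.
split=> [p Up|].
  have := cf p Up; rewrite /prop_for /continuous_at -fg//.
  by apply: cvg_trans (near_eq_cvg (near_open oU Up _)) => q Uq; rewrite fg.
case: H => df H; split=> [p i Up|i].
  by apply: near_eq_derivable (df p i Up); exact: near_open fg.
by apply: IH (H i); exact: eq_on_open_partial.
Qed.

(** The derivatives may be explicit expressions that are correct only on U; openness makes that
    enough. *)
Lemma CkS_intro U k f (df : 'I_m -> 'cV[R]_m -> R^o) : open U ->
  (forall p, U p -> {for p, continuous f}) ->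
  (forall p i, U p -> is_derive p (evec i) f (df i p)) ->
  (forall i, Ck U k (df i)) -> Ck U k.+1 f.
Proof.
move=> oU cf dfP H; split=> //; split=> [p i Up|i]; first by case: (dfP p i Up).
by apply: (eq_Ck oU) (H i) => p Up; have [_ <-] := dfP p i Up.
Qed.

Lemma Ck_cst U k (c : R) : open U -> Ck U k (fun=> c).
Proof.
move=> oU; elim: k c => [|k IH] c.
  by split=> // p Up; exact: cst_continuous.
apply: (@CkS_intro _ _ _ (fun _ _ => 0)) => //.
by move=> p _; exact: cst_continuous.
Qed.

Lemma is_derive_coord (p v : 'cV[R]_m) i j :
  is_derive p v (fun x : 'cV[R]_m => x i j : R^o) (v i j).
Proof.
have dc : differentiable (fun x : 'cV[R]_m => x i j : R^o) p
  by exact: differentiable_coord.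
apply: DeriveDef; first exact: diff_derivable.
rewrite deriveE//.
have @l : {linear 'cV[R]_m -> R^o}.
  by exists (fun N : 'cV[R]_m => N i j); do 2![eexists]; do ?[constructor];
    rewrite ?mxE// => ? *; rewrite ?mxE//; move=> ?; rewrite !mxE.
by rewrite (@diff_lin _ _ _ l)//; exact: coord_continuous.
Qed.

Lemma Ck_coord U k i j : open U -> Ck U k (fun x : 'cV[R]_m => x i j : R^o).
Proof.
move=> oU; case: k => [|k].
  by split=> // p Up; exact: coord_continuous.
apply: (@CkS_intro _ _ _ (fun l _ => ((evec l) : 'cV[R]_m) i j)) => //.
- by move=> p Up; exact: coord_continuous.
- by move=> p l Up; exact: is_derive_coord.
- by move=> l; exact: Ck_cst.
Qed.

Lemma CkD U k f g : open U -> Ck U k f -> Ck U k g ->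
  Ck U k (fun p => f p + g p).
Proof.
move=> oU; elim: k f g => [|k IH] f g Hf Hg.
  by split=> // p Up; apply: continuousD;
    [exact: Ck_continuous Hf Up|exact: Ck_continuous Hg Up].
apply: (@CkS_intro _ _ _ (fun i p => partial i f p + partial i g p)) => //.
- by move=> p Up; apply: continuousD;
    [exact: Ck_continuous Hf Up|exact: Ck_continuous Hg Up].
- by move=> p i Up; apply: is_deriveD;
    [exact: Ck_is_derive Hf Up|exact: Ck_is_derive Hg Up].
- by move=> i; apply: IH; exact: Ck_partial.
Qed.

Lemma CkM U k f g : open U -> Ck U k f -> Ck U k g ->
  Ck U k (fun p => f p * g p : R^o).
Proof.
move=> oU; elim: k f g => [|k IH] f g Hf Hg.
  by split=> // p Up; apply: continuousM;
    [exact: Ck_continuous Hf Up|exact: Ck_continuous Hg Up].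
apply: (@CkS_intro _ _ _ (fun i p => f p * partial i g p + g p * partial i f p)) => //.
- by move=> p Up; apply: continuousM;
    [exact: Ck_continuous Hf Up|exact: Ck_continuous Hg Up].
- by move=> p i Up; apply: is_deriveM;
    [exact: Ck_is_derive Hf Up|exact: Ck_is_derive Hg Up].
- move=> i; apply: CkD => //; apply: IH; by [exact: CkW|exact: Ck_partial].
Qed.

Lemma CkN U k f : open U -> Ck U k f -> Ck U k (fun p => - f p).
Proof.
move=> oU H; apply: (@eq_Ck _ _ (fun p => -1 * f p : R^o)) => //.
  by move=> p _; rewrite mulN1r.
by apply: CkM => //; exact: Ck_cst.
Qed.

Lemma CkB U k f g : open U -> Ck U k f -> Ck U k g ->
  Ck U k (fun p => f p - g p).
Proof. by move=> oU Hf Hg; apply: CkD => //; exact: CkN. Qed.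

(** Regularity is asked of g' o f rather than of g'. When g' is an expression in g itself, as for
    the exponential, the inverse and [kappa], the hypothesis is supplied by the induction on k. *)
Lemma CkS_comp U k f (g g' : R -> R) : open U ->
  (forall p, U p -> is_derive (f p : R) 1 g (g' (f p))) ->
  Ck U k (fun p => g' (f p)) -> Ck U k.+1 f -> Ck U k.+1 (fun p => g (f p)).
Proof.
move=> oU dg Hg' Hf.
apply: (@CkS_intro _ _ _ (fun i p => partial i f p * g' (f p))) => //.
- move=> p Up; apply: continuous_comp; first exact: Ck_continuous Hf Up.
  exact: is_derive_real_continuous (dg p Up).
- move=> p i Up; apply: is_derive_comp_real; last exact: dg.
  exact: Ck_is_derive Hf Up.
- by move=> i; apply: CkM => //; exact: Ck_partial.
Qed.

Lemma C0_comp U f (g g' : R -> R) :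
  (forall p, U p -> is_derive (f p : R) 1 g (g' (f p))) ->
  Ck U 0 f -> Ck U 0 (fun p => g (f p)).
Proof.
move=> dg Hf; split=> // p Up.
apply: continuous_comp; first exact: Ck_continuous Hf Up.
exact: is_derive_real_continuous (dg p Up).
Qed.

Lemma Ck_expR U k f : open U -> Ck U k f -> Ck U k (fun p => expR (f p)).
Proof.
move=> oU; elim: k f => [|k IH] f Hf.
  by apply: (C0_comp (g' := expR)) => // p _; exact: is_derive_expR.
apply: (@CkS_comp U k f expR expR oU _ _ Hf).
by apply: IH; exact: CkW.
Qed.

Lemma Ck_inv U k f : open U -> (forall p, U p -> f p != 0) ->
  Ck U k f -> Ck U k (fun p => (f p)^-1 : R^o).
Proof.
move=> oU f0.
have dP p : U p -> is_derive (f p : R) 1 (fun x : R => x^-1)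
    (- ((f p)^-1 * (f p)^-1)).
  move=> Up; apply: is_derive_eq; first by apply: is_deriveV; exact: f0.
  by rewrite /GRing.scale/= mulr1 expr2 invfM.
elim: k f f0 dP => [|k IH] f f0 dP Hf.
  exact: (C0_comp (g' := fun x => - (x^-1 * x^-1))).
apply: (CkS_comp (g' := fun x => - (x^-1 * x^-1))) => //.
have := IH f f0 dP (CkW Hf) => H.
by apply: CkN => //; apply: CkM.
Qed.

Lemma Ck_ln U k f : open U -> (forall p, U p -> 0 < f p) ->
  Ck U k f -> Ck U k (fun p => ln (f p) : R^o).
Proof.
move=> oU f0.
case: k => [|k] Hf.
  apply: (C0_comp (g' := fun x => x^-1)) => // p Up.
  by apply: is_derive1_ln; exact: f0.
apply: (CkS_comp (g' := fun x => x^-1)) => //.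
  by move=> p Up; apply: is_derive1_ln; exact: f0.
apply: Ck_inv => //; last exact: CkW.
by move=> p Up; rewrite gt_eqF// f0.
Qed.

Lemma Ck_powR U k f a : open U -> (forall p, U p -> 0 < f p) ->
  Ck U k f -> Ck U k (fun p => (f p : R) `^ a : R^o).
Proof.
move=> oU f0 Hf.
apply: (@eq_Ck _ _ (fun p => expR (a * ln (f p)) : R^o)) => //.
  by move=> p Up; rewrite /powR gt_eqF// f0.
apply: Ck_expR => //; apply: CkM => //; first exact: Ck_cst.
exact: Ck_ln.
Qed.

Lemma Ck_sqrt U k f : open U -> (forall p, U p -> 0 < f p) ->
  Ck U k f -> Ck U k (fun p => Num.sqrt (f p : R) : R^o).
Proof.
move=> oU f0 Hf.
apply: (@eq_Ck _ _ (fun p => (f p : R) `^ 2^-1 : R^o)); [by []| |exact: Ck_powR].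
by move=> p Up; rewrite powR12_sqrt// ltW// f0.
Qed.

End Ck.

(** * Continuous partial derivatives imply differentiability *)

Section differentiability.
Context {R : realType} {m : nat}.
Implicit Types (U : set 'cV[R]_m) (f : 'cV[R]_m -> R^o).

Local Notation evec i := (delta_mx i 0 : 'cV[R]_m).

Lemma cV_sum_delta n (v : 'cV[R]_n) : v = \sum_i v i 0 *: delta_mx i 0.
Proof.
rewrite {1}(matrix_sum_delta v); apply: eq_bigr => i _.
by rewrite big_ord1.
Qed.

Lemma mx_norm_coord (n : nat) (v : 'M[R]_(m, n)) i j : `|v i j| <= `|v|.
Proof.
rewrite [leRHS]/Num.Def.normr/= mx_normrE.
exact: (le_bigmax _ (fun ij : 'I_m * 'I_n => `|v ij.1 ij.2|) (i, j)).
Qed.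

Lemma norm_mx_le (n k : nat) (v : 'M[R]_(n, k)) (e : R) : 0 <= e ->
  (forall i j, `|v i j| <= e) -> `|v| <= e.
Proof.
by move=> e0 H; rewrite /Num.Def.normr/= mx_normrE bigmax_le// => -[i j] _ /=.
Qed.

Lemma cvg_mx_entries (T : Type) (F : set_system T) {FF : Filter F} (n k : nat)
    (f : T -> 'M[R]_(n, k)) (l : 'M[R]_(n, k)) :
  (forall i j, f x i j @[x --> F] --> l i j) -> f x @[x --> F] --> l.
Proof.
move=> H; apply/cvgrPdist_le => e e0; near=> x.
apply: norm_mx_le => [|i j]; first exact: ltW.
rewrite !mxE; move: i j; near: x; apply: filter_forall => i.
apply: filter_forall => j.
by have /cvgrPdist_le := H i j; exact.
Unshelve. all: by end_near. Qed.

Lemma norm_evec i : `|evec i| <= 1.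
Proof.
apply: norm_mx_le => // k l.
by rewrite mxE; case: (_ && _); rewrite ?normr1 ?normr0.
Qed.

(* Telescoping the increment of f along the coordinates listed in s. *)
Lemma C1_partial_expansion U f p (s : seq 'I_m) : open U -> Ck U 1 f -> U p ->
  forall e : R, 0 < e -> exists2 d : R, 0 < d & forall h : 'cV[R]_m, `|h| < d ->
    `|f (\sum_(i <- s) h i 0 *: evec i + p) - f p
      - \sum_(i <- s) h i 0 * partial i f p| <= e * `|h|.
Proof.
move=> oU Hf Up; elim: s => [|i s IH] e e0.
  exists 1 => // h _; rewrite !big_nil add0r !subrr normr0.
  by rewrite mulr_ge0// ltW.
have e20 : 0 < e / 2 by rewrite divr_gt0.
have [d d0 Hd] := IH _ e20.
have cf : {for p, continuous (partial i f)}.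
  exact: Ck_continuous (Ck_partial i Hf) Up.
have : \forall q \near p, U q /\ `|partial i f p - partial i f q| <= e / 2.
  apply: filterI; first exact: open_nbhs_nbhs.
  by move/cvgrPdist_le : cf; exact.
case/nbhs_normP => r /= r0 Hr.
(* Each coordinate step moves by at most [|h|] in the maximum norm, so every intermediate point of
   the telescoping is within c [|h|] of p. *)
pose c : R := (size s).+1%:R.
have c0 : 0 < c by rewrite ltr0n.
exists (Num.min d (r / c)); first by rewrite lt_min d0 divr_gt0.
move=> h; rewrite lt_min => /andP[hd hr].
have near_p t : `|t| <= `|h i 0| ->
    ball_ Num.norm p r (t *: evec i + (\sum_(i <- s) h i 0 *: evec i + p)).
  move=> th; rewrite /ball_/= addrA opprD addrCA subrr addr0 normrN.
  apply: (@le_lt_trans _ _ (c * `|h|)); last by rewrite mulrC -ltr_pdivlMr.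
  rewrite /c -natr1 mulrDl mul1r addrC (le_trans (ler_normD _ _))// lerD//; last first.
    rewrite normrZ -[leRHS]mulr1 ler_pM//; last exact: norm_evec.
    exact: le_trans th (mx_norm_coord _ _ _).
  rewrite (le_trans (ler_norm_sum _ _ _))//.
  apply: (@le_trans _ _ (\sum_(j <- s) `|h|)); last first.
    by rewrite big_const_seq count_predT iter_addr_0 mulr_natl.
  apply: ler_sum => j _.
  rewrite normrZ -[leRHS]mulr1 ler_pM//; first exact: mx_norm_coord.
  exact: norm_evec.
rewrite !big_cons -[_ + _ + p]addrA.
set q := \sum_(j <- s) _ + p in near_p *.
have [t th E] : exists2 t : R, `|t| <= `|h i 0| &
    f (h i 0 *: evec i + q) - f q = h i 0 * partial i f (t *: evec i + q).
  apply: (@mean_value_along _ _ f (partial i f)) => t th.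
  by apply: Ck_is_derive Hf _; have [] := Hr _ (near_p t th).
rewrite [X in `|X|](_ : _ = (f q - f p - \sum_(j <- s) h j 0 * partial j f p) +
    h i 0 * (partial i f (t *: evec i + q) - partial i f p)); last first.
  by rewrite mulrBr -E; ring.
rewrite (le_trans (ler_normD _ _))// [e in leRHS](splitr e) mulrDl lerD//.
  exact: Hd.
rewrite normrM mulrC ler_pM//; last exact: mx_norm_coord.
by rewrite distrC; have [] := Hr _ (near_p t th).
Qed.

(** [Ck] speaks only of coordinate directions; this extends it to all directions, linearly, as
    second derivatives along lines and injectivity of differentials require. *)
Lemma C1_differentiable U f p : open U -> Ck U 1 f -> U p ->
  differentiable f p /\ forall v, 'd f p v = \sum_i v i 0 * partial i f p.
Proof.
move=> oU Hf Up.
pose l (v : 'cV[R]_m) : R^o := \sum_i v i 0 * partial i f p.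
have ll : linear l.
  move=> a u v; rewrite /l scaler_sumr -big_split/=; apply: eq_bigr => i _.
  by rewrite !mxE mulrDl -mulrA.
pose lM := GRing.isLinear.Build _ _ _ _ _ ll.
pose lL : {linear 'cV[R]_m -> R^o} := HB.pack l lM.
have lc : continuous lL.
  suff H s : continuous (fun v : 'cV[R]_m =>
      \sum_(i <- s) v i 0 * partial i f p : R^o) by exact: H.
  elim: s => [|i s IH] v.
    by under eq_fun do rewrite big_nil; exact: cst_continuous.
  under eq_fun do rewrite big_cons.
  apply: (@continuousD _ _ _ (fun v : 'cV[R]_m => v i 0 * partial i f p : R^o)
    (fun v => \sum_(j <- s) v j 0 * partial j f p : R^o)); last exact: IH.
  by apply: continuousM; [exact: coord_continuous|exact: cst_continuous].
have [D1 D2] : is_diff p f lL.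
  apply: is_diff_expansion => // e e0.
  have [d d0 H] := C1_partial_expansion (enum 'I_m) oU Hf Up e0.
  exists d => // h /H; by rewrite !big_enum/= -cV_sum_delta /l.
by split=> // v; rewrite D2.
Qed.

Lemma vec_differentiable n U (f : 'cV[R]_m -> 'cV[R]_n) p : open U ->
  (forall j, Ck U 1 (fun q => f q j 0 : R^o)) -> U p ->
  differentiable f p /\
  forall v j, 'd f p v j 0 = \sum_i v i 0 * partial i (fun q => f q j 0 : R^o) p.
Proof.
move=> oU Hf Up.
have E : f = \sum_j (fun q => f q j 0 *: (delta_mx j 0 : 'cV[R]_n)).
  by apply/funext => q; rewrite {1}(cV_sum_delta (f q)) fct_sumE.
have H j : differentiable (fun q => f q j 0 *: (delta_mx j 0 : 'cV[R]_n)) p.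
  by apply: differentiableZl; have [] := C1_differentiable oU (Hf j) Up.
have D : differentiable f p.
  by rewrite E; exact: differentiable_sum.
split=> // v j.
have [dj <-] := C1_differentiable oU (Hf j) Up.
rewrite -!deriveE// derive_mx ?mxE//; exact: diff_derivable.
Qed.

(** Iterated partial derivatives of a vector map are the columns of those of its coordinates; the
    identification holds on U only and is carried through the induction on the list. *)
Lemma vec_smooth_on n U (f : 'cV[R]_m -> 'cV[R]_n) : open U ->
  (forall j k, Ck U k (fun q => f q j 0 : R^o)) ->
  smooth_on U f.
Proof.
move=> oU Hf s p Up.
pose F s := foldr (fun i => @partial R m 'cV[R]_n i) f s.
pose G s j := foldr (fun i => @partial R m R^o i) (fun q => f q j 0) s.
have HG t j : forall k, Ck U k (G t j).
  by elim: t => [|i t IH] k /=; [exact: Hf|exact/Ck_partial/IH].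
have FD t q : U q -> F t q = \col_j G t j q.
  elim: t q => [|i t IH] q Uq; first by apply/colP => j; rewrite mxE.
  rewrite /= {1}/partial.
  rewrite (@near_eq_derive _ _ _ _ (fun q => \col_j G t j q)); last first.
    exact: near_open IH.
  rewrite derive_mx; last first.
    apply/derivable_mxP => a b.
    have [+ _] := Ck_is_derive i (HG t a 1) Uq.
    by rewrite (_ : (fun x => _) = G t a)//; apply/funext => x; rewrite mxE.
  apply/colP => j; rewrite !mxE /G/=.
  by rewrite (_ : (fun x => _) = G t j)//; apply/funext => x; rewrite mxE.
split.
  rewrite /prop_for /continuous_at -/(F s) FD//.
  have : (\col_j G s j q) @[q --> p] --> \col_j G s j p.
    apply: (@cvg_mx_entries _ (nbhs p)) => j k; rewrite mxE; under eq_fun do rewrite mxE.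
    exact: Ck_continuous (HG s j 0) Up.
  by apply: cvg_trans (near_eq_cvg (near_open oU Up _)) => q Uq; rewrite FD.
move=> i; apply: (@near_eq_derivable _ _ _ (fun q => \col_j G s j q)).
  by apply: (near_open oU Up) => q Uq; rewrite -/(F s) FD.
apply/derivable_mxP => a b.
have [+ _] := Ck_is_derive i (HG s a 1) Up.
by rewrite (_ : (fun x => _) = G s a)//; apply/funext => x; rewrite mxE.
Unshelve. all: by end_near. Qed.

End differentiability.

(** * Uniqueness of the canonical potential *)

Section posdef_det.
Context {R : realType}.

Definition qform n (A : 'M[R]_n) (v : 'cV[R]_n) : R := (v^T *m A *m v) 0 0.

Lemma qform_block n (a : R) (u : 'cV[R]_n) (B : 'M[R]_n) (t : R) (w : 'cV[R]_n) :
  qform (block_mx a%:M u^T u B) (col_mx t%:M w) =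
  a * t ^+ 2 + 2 * t * (u^T *m w) 0 0 + qform B w.
Proof.
rewrite /qform tr_col_mx mul_row_block mul_row_col tr_scalar_mx.
rewrite !mulmxDl [LHS]mxE [X in X + _]mxE [X in _ + X]mxE.
have -> : (w^T *m u *m t%:M) 0 0 = t * (u^T *m w) 0 0.
  by rewrite mul_mx_scalar mxE -[w^T *m u]trmxK trmx_mul trmxK mxE.
have -> : (t%:M *m u^T *m w) 0 0 = t * (u^T *m w) 0 0.
  by rewrite mul_scalar_mx -scalemxAl mxE.
have -> : (t%:M *m a%:M *m (t%:M : 'M[R]_1)) 0 0 = a * t ^+ 2.
  by rewrite -!scalar_mxM mxE eqxx mulr1n; ring.
by ring.
Qed.

Lemma qform_schur n (a : R) (u w : 'cV[R]_n) (B : 'M[R]_n) :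
  qform (B - a^-1 *: (u *m u^T)) w = qform B w - a^-1 * ((u^T *m w) 0 0) ^+ 2.
Proof.
rewrite /qform mulmxBr mulmxBl [LHS]mxE [X in _ + X]mxE; congr (_ - _).
rewrite -scalemxAr -scalemxAl mxE; congr (_ * _).
have -> : w^T *m (u *m u^T) *m w = (w^T *m u) *m (u^T *m w) by rewrite !mulmxA.
rewrite [LHS]mxE big_ord1 expr2; congr (_ * _).
by rewrite -[w^T *m u]trmxK trmx_mul trmxK mxE.
Qed.

Lemma det_schur n (a : R) (u : 'cV[R]_n) (B : 'M[R]_n) : a != 0 ->
  \det (block_mx a%:M u^T u B : 'M[R]_(1 + n)) =
  a * \det (B - a^-1 *: (u *m u^T)).
Proof.
move=> a0.
have -> : block_mx a%:M u^T u B = block_mx 1%:M 0 (a^-1 *: u) 1%:M *m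
    block_mx a%:M u^T 0 (B - a^-1 *: (u *m u^T)).
  rewrite mulmx_block !mul1mx !mul0mx !addr0 -!scalemxAl.
  by rewrite mul_mx_scalar scalerA mulVf// scale1r addrC subrK.
by rewrite det_mulmx det_lblock det_ublock !det1 !mul1r det_scalar1.
Qed.

Lemma posdef_block n (A : 'M[R]_(1 + n)) : posdef A ->
  exists a u B, [/\ A = block_mx a%:M u^T u B, 0 < a &
    posdef (B - a^-1 *: (u *m u^T))].
Proof.
move=> [At Ap].
pose a := A 0 0; pose u := dlsubmx A; pose B := drsubmx A.
have EA : A = block_mx a%:M u^T u B.
  rewrite -{1}(submxK A); congr block_mx.
    by rewrite [LHS]mx11_scalar; congr _%:M; rewrite !mxE; congr (A _ _);
      exact/val_inj.
  by rewrite /u trmx_dlsub At.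
have Bt : B^T = B by rewrite /B trmx_drsub At.
have Q t w : qform A (col_mx t%:M w) =
    a * t ^+ 2 + 2 * t * (u^T *m w) 0 0 + qform B w by rewrite {1}EA qform_block.
have a0 : 0 < a.
  have := Ap (col_mx 1%:M 0).
  rewrite -/(qform A _) Q mulmx0 /qform trmx0 !mul0mx mxE; rewrite !mulr0 !addr0 expr1n mulr1.
  apply; rewrite col_mx_eq0 negb_and; apply/orP; left.
  by apply/eqP => /matrixP/(_ 0 0); rewrite !mxE eqxx => /eqP; rewrite oner_eq0.
exists a, u, B; split=> //; split.
  by rewrite linearB/= linearZ/= trmx_mul trmxK Bt.
move=> w w0; rewrite -/(qform _ w) qform_schur.
(* This first coordinate minimizes the form of A for given w, and the minimum is the form of the
   Schur complement. *)
have := Ap (col_mx (- a^-1 * (u^T *m w) 0 0)%:M w).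
rewrite -/(qform A _) Q => H.
suff -> : qform B w - a^-1 * (u^T *m w) 0 0 ^+ 2 =
   a * (- a^-1 * (u^T *m w) 0 0) ^+ 2 +
    2 * (- a^-1 * (u^T *m w) 0 0) * (u^T *m w) 0 0 + qform B w.
  by apply: H; rewrite col_mx_eq0 negb_and w0 orbT.
by field; rewrite gt_eqF.
Qed.

Lemma posdef_det_gt0 n (A : 'M[R]_n) : posdef A -> 0 < \det A.
Proof.
elim: n A => [|n IH] A; first by rewrite det_mx00.
move=> /(@posdef_block n)[a [u [B [-> a0 Sp]]]].
by rewrite det_schur ?gt_eqF// mulr_gt0// IH.
Qed.

(** Induction on the size by Schur complements. The form of a Schur complement is the minimum of the
    full form over the first coordinate, so it inherits the inequality: both forms are evaluated at
    the minimizer belonging to B. *)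
Lemma ler_det_posdef n (A B : 'M[R]_n) : posdef A -> posdef B ->
  (forall v, qform A v <= qform B v) -> \det A <= \det B.
Proof.
elim: n A B => [|n IH] A B; first by rewrite !det_mx00.
move=> /(@posdef_block n)[a [u [A' [-> a0 Sp]]]].
move=> /(@posdef_block n)[b [w [B' [-> b0 Tp]]]] AB.
rewrite !det_schur ?gt_eqF//.
have ab : a <= b.
  have := AB (col_mx (1%:M : 'M[R]_1) (0 : 'cV[R]_n)); rewrite !qform_block !mulmx0 /qform trmx0 !mul0mx.
  by rewrite mxE !mulr0 !addr0 expr1n !mulr1.
apply: ler_pM => //; [exact: ltW|exact/ltW/posdef_det_gt0|].
apply: IH => // v; rewrite !qform_schur.
have := AB (col_mx ((- b^-1 * (w^T *m v) 0 0)%:M : 'M[R]_1) v); rewrite !qform_block.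
set s := (u^T *m v) 0 0; set t := (w^T *m v) 0 0; set q := qform A' v => H.
apply: (@le_trans _ _ (a * (- b^-1 * t) ^+ 2 + 2 * (- b^-1 * t) * s + q)).
  have -> : q - a^-1 * s ^+ 2 = a * (- b^-1 * t) ^+ 2 + 2 * (- b^-1 * t) * s + q
     - a * (s / a - t / b) ^+ 2.
    by field; rewrite !gt_eqF.
  by rewrite gerBl mulr_ge0 ?sqr_ge0// ltW.
apply: (le_trans H); rewrite le_eqVlt; apply/orP; left; apply/eqP.
by field; rewrite gt_eqF.
Qed.

(* Sylvester: det (1 + e l) = 1 + l e. *)
Lemma det_rank1_update n (e : 'cV[R]_n) (l : 'rV[R]_n) :
  \det (1%:M + e *m l) = 1 + (l *m e) 0 0.
Proof.
pose M : 'M[R]_(1 + n) := block_mx 1%:M (- l) e 1%:M.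
(* Eliminating in M on either side leaves 1 + e l in one corner or the scalar 1 + l e in the
   other. *)
have E1 : M = block_mx 1%:M 0 e 1%:M *m block_mx 1%:M (- l) 0 (1%:M + e *m l).
  by rewrite mulmx_block !mul1mx !mul0mx !mulmx1 !addr0 mulmxN [- _ + _]addrC addrK.
have E2 : M = block_mx (1%:M + l *m e) (- l) 0 1%:M *m block_mx 1%:M 0 e 1%:M.
  by rewrite mulmx_block !mul1mx !mul0mx !mulmx1 !mulmx0 !add0r mulNmx addrK.
have : \det M = \det M by [].
rewrite {1}E1 E2 !det_mulmx !det_lblock !det_ublock !det1 !mul1r !mulr1 => ->.
by rewrite {1}[_ + _]mx11_scalar det_scalar1 !mxE eqxx.
Qed.

End posdef_det.

(** * Second derivatives along lines *)

Section second_derivative.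
Context {R : realType}.

(** The first derivative vanishes at 0. If d were positive, it would be positive just to the right
    of 0, and the mean value theorem would put a larger value of g there. *)
Lemma second_derivative_le0_at_max (g dg : R -> R) (r d : R) : 0 < r ->
  (forall t : R, `|t| < r -> is_derive t 1 g (dg t)) ->
  is_derive (0 : R) 1 dg d -> (forall t, `|t| < r -> g t <= g 0) -> d <= 0.
Proof.
move=> r0 Hg Hdg gmax.
have inr t : (t \in `](- r), r[%R) = (`|t| < r) by rewrite in_itv/= ltr_norml.
have dg0 : dg 0 = 0.
  have H : is_derive (0 : R) 1 g 0.
    apply: (@derive1_at_max _ g (- r) r 0).
    - by rewrite (@le_trans _ _ 0)// ?oppr_le0 ltW.
    - by move=> t; rewrite inr => /Hg[].
    - by rewrite inr normr0.
    - by move=> t; rewrite inr => /gmax.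
  have n0 : `|0 : R| < r by rewrite normr0.
  by have [_ <-] := Hg 0 n0; have [] := H.
rewrite leNgt; apply/negP => d0.
have [cd ld] := Hdg.
have lim : h^-1 *: (dg (h%:A + 0) - dg 0) @[h --> 0^'] --> d.
  by rewrite -ld; exact: cd.
have [s /= s0 Hs] : \forall h \near (0 : R)^', 0 < h^-1 *: (dg (h%:A + 0) - dg 0).
  exact: (cvgr_gt _ lim).
have pos t : 0 < t -> t < s -> 0 < dg t.
  move=> t0 ts; have := Hs t; rewrite /= sub0r normrN gtr0_norm// => /(_ ts).
  rewrite gt_eqF// => /(_ isT).
  by rewrite dg0 subr0 addr0 [t%:A]mulr1 pmulr_rgt0// invr_gt0.
pose t := Num.min (r / 2) (s / 2).
have t0 : 0 < t by rewrite lt_min !divr_gt0.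
have tr : t < r by rewrite gt_min; apply/orP; left; lra.
have ts : t < s by rewrite gt_min; apply/orP; right; lra.
have H1 (x : R) : x \in `]0, t[%R -> is_derive x 1 g (dg x).
  rewrite in_itv/= => /andP[x0 xt]; apply: Hg.
  by rewrite gtr0_norm// (lt_trans xt).
have H2 : {within `[0, t], continuous g}.
  apply: derivable_within_continuous => x; rewrite in_itv/= => /andP[x0 xt].
  by have [] : is_derive x 1 g (dg x) by apply: Hg; rewrite ger0_norm// (le_lt_trans xt).
have [c] := MVT t0 H1 H2.
rewrite in_itv/= => /andP[c0 ct] E.
have : 0 < g t - g 0 by rewrite E subr0 mulr_gt0// pos// (lt_trans ct).
by rewrite subr_gt0 ltNge gmax// gtr0_norm.
Qed.

Context {m : nat}.
Implicit Types (U : set 'cV[R]_m) (f : 'cV[R]_m -> R^o).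

Lemma C1_is_derive U f p v : open U -> Ck U 1 f -> U p ->
  is_derive p v f (\sum_i v i 0 * partial i f p).
Proof.
move=> oU Hf Up; have [D E] := C1_differentiable oU Hf Up.
by apply: DeriveDef; [exact: diff_derivable|rewrite deriveE].
Qed.

Definition line_derivative f (p v : 'cV[R]_m) (t : R) : R :=
  \sum_i v i 0 * partial i f (t *: v + p).

Lemma is_derive_line U f (p v : 'cV[R]_m) (t : R) : open U -> Ck U 1 f -> U (t *: v + p) ->
  is_derive t 1 (fun s : R => f (s *: v + p)) (line_derivative f p v t).
Proof. by move=> oU Hf Up; apply: (@is_derive_line_at R _ R^o); exact: C1_is_derive Up. Qed.

Lemma is_derive_line2 U f (p v : 'cV[R]_m) (t : R) : open U -> Ck U 2 f -> U (t *: v + p) ->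
  is_derive t 1 (line_derivative f p v) (qform (hessian f (t *: v + p)) v).
Proof.
move=> oU Hf Up.
have E : line_derivative f p v =
    \sum_i (fun s : R => v i 0 * partial i f (s *: v + p) : R^o).
  by apply/funext => s; rewrite fct_sumE.
have -> : qform (hessian f (t *: v + p)) v =
    \sum_i v i 0 * line_derivative (partial i f) p v t.
  rewrite /qform mxE; under eq_bigr do rewrite mxE mulr_suml.
  apply: eq_bigr => i _.
  rewrite /line_derivative mulr_sumr; apply: eq_bigr => j _; rewrite !mxE; ring.
rewrite E; apply: is_derive_sum => i.
have H := is_derive_line oU (Ck_partial i Hf) Up.
exact: (@is_deriveZ _ _ _ (fun s : R => partial i f (s *: v + p)) (v i 0)).
Qed.

End second_derivative.

(** * The maximum principle *)

Section comparison.
Context {R : realType} {n : nat}.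
Implicit Types (K : set 'cV[R]_n.+1) (F G : 'cV[R]_n.+1 -> R).

Lemma interior_preimage (m k : nat) (A : set 'cV[R]_m) (B : set 'cV[R]_k)
    (g : 'cV[R]_m -> 'cV[R]_k) p :
  {for p, continuous g} -> B° (g p) -> (forall x, B (g x) -> A x) -> A° p.
Proof.
by move=> cg Bp BA; have := cg _ Bp; apply: (@filterS _ (nbhs p)) => x /BA.
Qed.

Lemma affine_continuous (m : nat) (a : R) (b : 'cV[R]_m) :
  continuous (fun x : 'cV[R]_m => a *: (x + b)).
Proof.
move=> x; apply: (@cvgZl_tmp _ _ _ (nbhs x)).
by apply: (@cvgD _ _ _ (nbhs x)); [exact: cvg_id|exact: cvg_cst].
Qed.

Lemma cone_interiorD K (x e : 'cV[R]_n.+1) (c : R) : regular_cone K ->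
  K x -> K° e -> 0 < c -> K° (x + c *: e).
Proof.
move=> [conv _ _ _] Kx Ke c0.
apply: (@interior_preimage _ _ _ K (fun y => c^-1 *: (y + - x))).
- exact: affine_continuous.
- by rewrite addrAC subrr add0r scalerA mulVf ?gt_eqF// scale1r.
- move=> y Ky; have := conv 1 c _ _ ler01 (ltW c0) Kx Ky.
  by rewrite scale1r scalerA mulfV ?gt_eqF// scale1r addrC subrK.
Qed.

Lemma cone_interiorZ K (x : 'cV[R]_n.+1) (c : R) : regular_cone K ->
  K° x -> 0 < c -> K° (c *: x).
Proof.
move=> reg Kx c0.
have Kx' : K x by exact: interior_subset.
have c20 : 0 < c / 2 by rewrite divr_gt0.
have := cone_interiorD reg (x := (c / 2) *: x) _ Kx c20.
rewrite -scalerDl -splitr; apply.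
by case: reg => + _ _ _ => /(_ (c / 2) 0 x x (ltW c20) (lexx 0) Kx' Kx'); rewrite scale0r addr0.
Qed.

(** Homogeneity with factor e at x = 0 would read F 0 = F 0 - (n + 1). *)
Lemma canonical_potential_neq0 K F x : canonical_potential K F -> K° x -> x != 0.
Proof.
move=> [_ _ hom] Kx; apply/eqP => x0; rewrite x0 in Kx.
have := hom (expR 1) 0 (expR_gt0 _) Kx.
rewrite scaler0 expRK mulr1 => /eqP; rewrite eq_sym subr_eq addrC -subr_eq subrr.
by rewrite eq_sym pnatr_eq0.
Qed.

Lemma norm_trmx (m k : nat) (A : 'M[R]_(m, k)) : `|A^T| = `|A|.
Proof.
apply/eqP; rewrite eq_le; apply/andP; split; apply: norm_mx_le => // i j.
  rewrite mxE; exact: mx_norm_coord.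
have -> : A i j = A^T j i by rewrite mxE.
exact: mx_norm_coord.
Qed.

Lemma trmx_continuous (m k : nat) : continuous (@trmx R m k).
Proof.
move=> A; apply: (@cvg_mx_entries _ _ (nbhs A)) => i j.
rewrite mxE; under eq_fun do rewrite mxE; exact: coord_continuous.
Qed.

(** Heine-Borel for row vectors, carried over by transposition, which is an isometry. *)
Lemma cV_bounded_closed_compact (m : nat) (A : set 'cV[R]_m) :
  bounded_set A -> closed A -> compact A.
Proof.
move=> [M [Mr HM]] cA.
have -> : A = @trmx R 1 m @` ((@trmx R 1 m) @^-1` A).
  apply/seteqP; split=> [x Ax|_ [y Ay <-]//].
  by exists x^T; rewrite /= trmxK.
apply: continuous_compact.
  by apply: continuous_subspaceT; exact: trmx_continuous.
apply: bounded_closed_compact.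
  exists M; split=> // x Mx y /= Ay; have := HM x Mx _ Ay.
  by rewrite /= norm_trmx.
by apply: closed_comp => // x _; exact: trmx_continuous.
Qed.

(* For lam > 0 the map x |-> x + lam * l(x) e sends K \ {0} into the interior. *)
Definition push (e : 'cV[R]_n.+1) (l : 'rV[R]_n.+1) (lam : R) : 'M[R]_n.+1 :=
  1%:M + (lam *: e) *m l.

Lemma pushE e l lam x : push e l lam *m x = x + (lam * (l *m x) 0 0) *: e.
Proof.
rewrite /push mulmxDl mul1mx -mulmxA; congr (_ + _).
by rewrite [l *m x]mx11_scalar mul_mx_scalar scalerA !mxE eqxx mulr1n mulrC.
Qed.

Lemma mulmx_continuous (m k : nat) (A : 'M[R]_(m, k)) :
  continuous (mulmx A : 'cV[R]_k -> 'cV[R]_m).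
Proof.
move=> x; apply: (@cvg_mx_entries _ _ (nbhs x)) => j j0; rewrite {j0}(ord1 j0).
rewrite mxE; under eq_fun do rewrite mxE.
suff H s : continuous (fun v : 'cV[R]_k => \sum_(i <- s) A j i * v i 0 : R^o)
  by exact: H.
elim: s => [|i s IH] v.
  by under eq_fun do rewrite big_nil; exact: cst_continuous.
under eq_fun do rewrite big_cons.
apply: (@continuousD _ _ _ (fun v : 'cV[R]_k => A j i * v i 0 : R^o)
  (fun v => \sum_(j0 <- s) A j j0 * v j0 0 : R^o)); last exact: IH.
by apply: continuousM; [exact: cst_continuous|exact: coord_continuous].
Qed.

Lemma qform_congr (A : 'M[R]_n.+1) (H : 'M[R]_n.+1) v :
  qform (A^T *m H *m A) v = qform H (A *m v).
Proof. by rewrite /qform trmx_mul !mulmxA. Qed.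

Lemma det_congr (A H : 'M[R]_n.+1) :
  \det (A^T *m H *m A) = \det A * \det A * \det H.
Proof. by rewrite !det_mulmx det_tr mulrAC. Qed.

Lemma posdef_congr (A H : 'M[R]_n.+1) : \det A != 0 -> posdef H ->
  posdef (A^T *m H *m A).
Proof.
move=> A0 [Ht Hp]; split; first by rewrite !trmx_mul trmxK Ht mulmxA.
move=> v v0; rewrite -/(qform _ v) qform_congr; apply: Hp.
apply: contra v0 => /eqP Av; apply/eqP.
have uA : A \in unitmx by rewrite unitmxE unitfE.
by rewrite -[v](mulKmx uA) Av mulmx0.
Qed.

Lemma potential_Ck2 K F : canonical_potential K F -> Ck K° 2 F.
Proof. by case=> _ [sF _ _ _] _; exact: ((smooth_onP K° (F : _ -> R^o)).1 sF 2). Qed.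

Lemma potential_continuous K F x : canonical_potential K F -> K° x ->
  {for x, continuous F}.
Proof. by move=> /potential_Ck2 H Kx; exact: (Ck_continuous H Kx). Qed.

Lemma push_interior K e l lam x : regular_cone K -> K° e -> 0 < lam ->
  K x -> 0 < (l *m x) 0 0 -> K° (push e l lam *m x).
Proof.
by move=> reg Ke lam0 Kx lx; rewrite pushE; apply: cone_interiorD => //; rewrite mulr_gt0.
Qed.

(* The gap F o A - G is homogeneous of degree 0, so the maximum may be sought on
   a compact slice; it exists because the gap tends to -oo at the boundary. *)
Lemma push_gap_max K F G (e : 'cV[R]_n.+1) (l : 'rV[R]_n.+1) lam :
  canonical_potential K F -> canonical_potential K G -> K° e -> 0 < lam ->
  (forall x, K x -> x != 0 -> 0 < (l *m x) 0 0) ->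
  exists2 c, K° c & forall x, K° x ->
    F (push e l lam *m x) - G x <= F (push e l lam *m c) - G c.
Proof.
move=> HF HG Ke lam0 lp.
have [reg mF homF] := HF; have [_ mG homG] := HG.
have cK : closed K by case: reg.
pose D x := F (push e l lam *m x) - G x.
have KA x : K x -> x != 0 -> K° (push e l lam *m x).
  by move=> Kx x0; apply: push_interior => //; exact: lp.
have KKo x : K° x -> K x by exact: interior_subset.
have Ko0 x : K° x -> x != 0 by exact: canonical_potential_neq0 HF.
have Dhom t x : 0 < t -> K° x -> D (t *: x) = D x.
  move=> t0 Kx; rewrite /D -scalemxAr homF//; last by apply: KA; [exact: KKo|exact: Ko0].
  by rewrite homG//; ring.
have Dcont x : K° x -> {for x, continuous D}.
  move=> Kx; apply: (@continuousB _ _ _ (fun x => F (push e l lam *m x) : R^o) (G : _ -> R^o)).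
    apply: continuous_comp; first exact: mulmx_continuous.
    by apply: potential_continuous HF _; apply: KA; [exact: KKo|exact: Ko0].
  exact: potential_continuous HG Kx.
have FAcont x : K x -> x != 0 -> {for x, continuous (fun x => F (push e l lam *m x))}.
  move=> Kx x0; apply: continuous_comp; first exact: mulmx_continuous.
  by apply: potential_continuous HF _; exact: KA.
have norm1 x : K° x -> K° (`|x|^-1 *: x) /\ `|(`|x|^-1 *: x)| = 1.
  move=> Kx; have nx : 0 < `|x| by rewrite normr_gt0 Ko0.
  split; first by apply: cone_interiorZ; rewrite ?invr_gt0.
  by rewrite normrZ ger0_norm ?invr_ge0// mulVf// gt_eqF.
(* The unit sphere meets each ray once. The bound from below by [D e] keeps the slice away from the
   boundary of K and so makes it closed. *)
pose T := [set x | [/\ K° x, `|x| = 1 & D e <= D x]].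
have T0 : T !=set0.
  have [K1 n1] := norm1 e Ke; exists (`|e|^-1 *: e); split=> //.
  by rewrite Dhom// invr_gt0 normr_gt0 Ko0.
have cT : closed T.
  move=> p Tp.
  have Kp : K p.
    by apply: cK => B /Tp [x [[Kx _ _] Bx]]; exists x; split=> //; exact: KKo.
  have np : `|p| = 1.
    have C := @norm_continuous _ _ p.
    case: (ltgtP `|p| 1) => // H.
      have /Tp : \forall x \near p, `|x| < 1 by exact: (cvgr_lt _ C).
      by case=> x [[_ -> _]]; rewrite ltxx.
    have /Tp : \forall x \near p, 1 < `|x| by exact: (cvgr_gt _ C).
    by case=> x [[_ -> _]]; rewrite ltxx.
  have p0 : p != 0 by rewrite -normr_gt0 np.
  (* At a boundary point p of norm 1, F o A is continuous because A p is interior, while G tends to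
     +oo; near p the gap would fall below [D e]. *)
  have Kop : K° p.
    apply: contrapT => nKp.
    have [_ _ _ bG] := mG.
    have clp : closure K p by exact: subset_closure.
    have N1 := FAcont _ Kp p0.
    have /Tp : \forall x \near p, F (push e l lam *m x) < F (push e l lam *m p) + 1 /\
       (K° x -> F (push e l lam *m p) + 1 - D e < G x).
      apply: filterI; first by apply: (cvgr_lt _ N1); rewrite ltrDl.
      have /cvgryPgt := bG p clp nKp.
      by move/(_ (F (push e l lam *m p) + 1 - D e)); rewrite near_withinE.
    case=> x [[Kx _ De] [H1 /(_ Kx) H2]].
    by move: De; rewrite /D leNgt => /negP; apply; move: H2; rewrite /D; lra.
  split=> //; rewrite leNgt; apply/negP => Dp.
  have /Tp : \forall x \near p, D x < D e by apply: (cvgr_lt _ (Dcont p Kop)).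
  by case=> x [[_ _ De]]; rewrite ltNge De.
have bT : bounded_set T.
  by exists 1; split=> // M M1 x [_ nx _]; rewrite /= nx; exact: ltW.
have [c] := compact_EVT_max T0 (cV_bounded_closed_compact bT cT)
   (f := D) (continuous_in_subspaceT (fun x Tx => Dcont x
     (let: And3 H _ _ := set_mem Tx in H))).
rewrite inE => -[Kc nc Dc] maxc; exists c => // x Kx; rewrite -!/(D _).
have [Kx1 nx1] := norm1 x Kx.
have Ex : D (`|x|^-1 *: x) = D x by rewrite Dhom// invr_gt0 normr_gt0 Ko0.
have [Hx|Hx] := leP (D e) (D x); last exact: le_trans (ltW Hx) Dc.
by rewrite -Ex; apply: maxc; rewrite inE; split=> //; rewrite Ex.
Qed.

Lemma push_gap_le0 K F G (e : 'cV[R]_n.+1) (l : 'rV[R]_n.+1) lam :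
  canonical_potential K F -> canonical_potential K G -> K° e -> 0 < lam ->
  (forall x, K x -> x != 0 -> 0 < (l *m x) 0 0) ->
  forall x, K° x -> F (push e l lam *m x) <= G x.
Proof.
move=> HF HG Ke lam0 lp x Kx.
have [c Kc maxc] := push_gap_max HF HG Ke lam0 lp.
have [reg [_ pF dF _] homF] := HF; have [_ [_ pG dG _] homG] := HG.
rewrite -subr_le0; apply: (le_trans (maxc x Kx)); rewrite subr_le0.
set A := push e l lam in maxc *.
have Ko0 y : K° y -> y != 0 by exact: canonical_potential_neq0 HF.
have KAy y : K° y -> K° (A *m y).
  move=> Ky; have Ky' : K y by exact: interior_subset.
  by apply: push_interior => //; apply: lp => //; exact: Ko0.
(* By Sylvester, det A = 1 + lam l(e), and l(e) > 0. *)
have detA : 1 <= \det A.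
  rewrite /A /push det_rank1_update lerDl -scalemxAr mxE mulr_ge0 ?ltW//.
  by apply: lp; [exact: interior_subset|exact: Ko0].
have KAc := KAy c Kc.
have oK : open K° by exact: open_interior.
(* Along the line c + t v the gap has a maximum at t = 0, so its second derivative there is at most
   0. *)
have Q v : qform (hessian F (A *m c)) (A *m v) <= qform (hessian G c) v.
  have cl : continuous (fun t : R => t *: v + c).
    move=> t; apply: cvgD; last exact: cvg_cst.
    by apply: cvgZr_tmp; exact: cvg_id.
  have : \forall t \near (0 : R), K° (t *: v + c).
    by apply: cl; rewrite scale0r add0r; exact: open_nbhs_nbhs.
  case/nbhs_normP => r /= r0 Hr.
  have Kt t : `|t| < r -> K° (t *: v + c).
    by move=> tr; apply: Hr; rewrite /ball_/= sub0r normrN.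
  have EA t : A *m (t *: v + c) = t *: (A *m v) + A *m c.
    by rewrite mulmxDr scalemxAr.
  rewrite -subr_le0.
  apply: (@second_derivative_le0_at_max _
    (fun t => F (t *: (A *m v) + A *m c) - G (t *: v + c))
    (fun t => line_derivative F (A *m c) (A *m v) t - line_derivative G c v t) r) => //.
  - move=> t tr; apply: (@is_deriveB _ _ _ (fun t : R => F (t *: (A *m v) + A *m c))
      (fun t : R => G (t *: v + c))).
      apply: (is_derive_line oK); first exact/CkW/potential_Ck2/HF.
      by rewrite -EA; exact/KAy/Kt.
    apply: (is_derive_line oK); first exact/CkW/potential_Ck2/HG.
    exact/Kt.
  - apply: (@is_deriveB _ _ _ (line_derivative F (A *m c) (A *m v)) (line_derivative G c v)).
      have := @is_derive_line2 _ _ _ F (A *m c) (A *m v) 0 oK (potential_Ck2 HF).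
      by rewrite scale0r add0r; exact.
    have := @is_derive_line2 _ _ _ G c v 0 oK (potential_Ck2 HG).
    by rewrite scale0r add0r; exact.
  - move=> t tr; have := maxc _ (Kt t tr).
    by rewrite EA !scale0r !add0r.
have PF := pF _ KAc; have PG := pG _ Kc.
have EF := dF _ KAc; have EG := dG _ Kc.
move: (hessian F (A *m c)) (hessian G c) PF PG EF EG Q => M N PF PG EF EG Q.
have dA0 : \det A != 0 by rewrite gt_eqF// (lt_le_trans ltr01).
(* With the Monge-Ampere equation this reads (det A)^2 exp (2 F(A c)) <= exp (2 G(c)); as det A >=
   1, F(A c) <= G(c) follows. *)
have := ler_det_posdef (posdef_congr dA0 PF) PG.
have H v : qform (A^T *m M *m A) v <= qform N v by rewrite qform_congr.
move=> /(_ H); rewrite det_congr EF EG.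
move=> /(fun h => le_trans _ h) H2.
rewrite -(@ler_pM2l _ 2)// -ler_expR; apply: H2.
by rewrite ler_peMl ?expR_ge0// -expr2 exprn_ege1.
Qed.

Lemma canonical_potential_le K F G (e : 'cV[R]_n.+1) (l : 'rV[R]_n.+1) :
  canonical_potential K F -> canonical_potential K G -> K° e ->
  (forall x, K x -> x != 0 -> 0 < (l *m x) 0 0) ->
  forall x, K° x -> F x <= G x.
Proof.
move=> HF HG Ke lp x Kx; rewrite leNgt; apply/negP => GF.
have cl : continuous (fun t : R => x + (t * (l *m x) 0 0) *: e).
  move=> t; apply: cvgD; first exact: cvg_cst.
  by apply: cvgZr_tmp; apply: cvgMr_tmp; exact: cvg_id.
have : \forall t \near (0 : R), G x < F (x + (t * (l *m x) 0 0) *: e).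
  have C : {for (0 : R), continuous (F \o (fun t : R => x + (t * (l *m x) 0 0) *: e))}.
    apply: continuous_comp; first exact: cl.
    by rewrite mul0r scale0r addr0; exact: potential_continuous HF Kx.
  rewrite /prop_for /continuous_at/= mul0r scale0r addr0 in C.
  exact: (cvgr_gt _ C).
case/nbhs_normP => r /= r0 Hr.
have r20 : 0 < r / 2 by rewrite divr_gt0.
have r2r : r / 2 < r by lra.
have := Hr (r / 2); rewrite /ball_/= sub0r normrN gtr0_norm// => /(_ r2r).
by rewrite -pushE ltNge (push_gap_le0 HF HG Ke r20 lp Kx).
Qed.

Theorem canonical_potential_unique K F G (e : 'cV[R]_n.+1) (l : 'rV[R]_n.+1) :
  canonical_potential K F -> canonical_potential K G -> K° e ->
  (forall x, K x -> x != 0 -> 0 < (l *m x) 0 0) ->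
  forall x, K° x -> F x = G x.
Proof.
move=> HF HG Ke lp x Kx; apply/eqP; rewrite eq_le.
by rewrite (canonical_potential_le HF HG Ke lp)// (canonical_potential_le HG HF Ke lp).
Qed.

End comparison.

(** * The canonical potential of the exponential cone *)

Section kappa.
Context {R : realType}.

Definition theta (k : R) : R := k + ln (1 + k) / 2.

(* kappa is the inverse of theta on the positive axis; it is 0 elsewhere. *)
Definition kappa (u : R) : R := xget 0 [set k | 0 < k /\ theta k = u].

Lemma is_derive_theta (k : R) : -1 < k ->
  is_derive k 1 theta (1 + (1 + k)^-1 / 2).
Proof.
move=> k1; have k0 : 0 < 1 + k by lra.
have H1 := dir_D (dir_cst k 1 1) (is_derive_id k 1).
have H2 := dir_D (is_derive_id k 1) (dir_M (dir_ln k0 H1) (dir_cst k 1 2^-1)).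
by apply: (is_derive_eq H2); field; rewrite gt_eqF.
Qed.

Lemma theta_continuous (k : R) : -1 < k -> {for k, continuous theta}.
Proof. by move=> /is_derive_theta/is_derive_real_continuous. Qed.

Lemma ltr_theta (a b : R) : -1 < a -> a < b -> theta a < theta b.
Proof.
move=> a1 ab; apply: ltrD => //.
by rewrite ltr_pM2r ?invr_gt0// ltr_ln ?posrE; lra.
Qed.

Lemma theta0 : theta 0 = 0.
Proof. by rewrite /theta addr0 ln1 mul0r addr0. Qed.

Lemma theta_surj (u : R) : 0 < u -> exists k, 0 < k /\ theta k = u.
Proof.
move=> u0.
have uu : u <= theta u.
  by rewrite /theta lerDl divr_ge0// ln_ge0; lra.
have cth : {within `[0, u], continuous theta}.
  apply: derivable_within_continuous => x; rewrite in_itv/= => /andP[x0 _].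
  have x1 : -1 < x by lra.
  by have [] := is_derive_theta x1.
have [|c] := IVT (ltW u0) cth (v := u).
  by rewrite theta0 ge_min le_max (ltW u0) uu orbT.
rewrite in_itv/= => /andP[c0 _] E; exists c; split=> //.
rewrite lt_neqAle c0 andbT; apply/eqP => c00.
by move: E u0; rewrite -c00 theta0 => <-; rewrite ltxx.
Qed.

Lemma kappa_gt0 (u : R) : 0 < u -> 0 < kappa u.
Proof. by move=> /theta_surj/(xgetPex 0)[]. Qed.

Lemma thetaK (u : R) : 0 < u -> theta (kappa u) = u.
Proof. by move=> /theta_surj/(xgetPex 0)[]. Qed.

Lemma theta_gt0 (k : R) : 0 < k -> 0 < theta k.
Proof. by move=> k0; rewrite -theta0; apply: ltr_theta; lra. Qed.

Lemma kappaK (k : R) : 0 < k -> kappa (theta k) = k.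
Proof.
move=> k0; have t0 := theta_gt0 k0.
have H1 := kappa_gt0 t0; have H2 := thetaK t0.
case: (ltgtP (kappa (theta k)) k) => // H.
  have : theta (kappa (theta k)) < theta k by apply: ltr_theta; lra.
  by rewrite H2 ltxx.
have : theta k < theta (kappa (theta k)) by apply: ltr_theta; lra.
by rewrite H2 ltxx.
Qed.

Lemma kappa_le (u : R) : 0 < u -> kappa u <= u.
Proof.
move=> u0; have k0 := kappa_gt0 u0; rewrite -{2}(thetaK u0) /theta lerDl.
by rewrite divr_ge0// ln_ge0; lra.
Qed.

(** The reciprocal of the derivative of [theta] at [kappa u], written as a rational function of
    [kappa u] so that smoothness can bootstrap. *)
Definition dkappa (u : R) : R := 2 * (1 + kappa u) / (2 * kappa u + 3).

Lemma is_derive_kappa (u : R) : 0 < u -> is_derive u 1 kappa (dkappa u).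
Proof.
move=> u0; have k0 := kappa_gt0 u0.
have k1 : -1 < kappa u by lra.
have H : is_derive (theta (kappa u)) 1 kappa (1 + (1 + kappa u)^-1 / 2)^-1.
  apply: (@is_derive_inverse _ theta).
  - by near=> k; apply: kappaK; near: k; exact: lt_nbhsr.
  - near=> k; apply: theta_continuous.
    have : 0 < k by near: k; exact: lt_nbhsr.
    by lra.
  - exact: is_derive_theta.
  - rewrite gt_eqF// addr_gt0// divr_gt0// invr_gt0; lra.
rewrite thetaK// in H; apply: (is_derive_eq H); rewrite /dkappa.
by field; rewrite ?gt_eqF//; lra.
Unshelve. all: by end_near. Qed.

Lemma Ck_kappa (m : nat) (U : set 'cV[R]_m) k (f : 'cV[R]_m -> R^o) : open U ->
  (forall p, U p -> 0 < f p) ->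
  Ck U k f -> Ck U k (fun p => kappa (f p) : R^o).
Proof.
move=> oU f0.
have dP p : U p -> is_derive (f p : R) 1 kappa (dkappa (f p)).
  by move=> Up; apply: is_derive_kappa; exact: f0.
elim: k => [|k IH] Hf; first exact: (C0_comp (g' := dkappa)).
apply: (CkS_comp (g' := dkappa)) => //.
have H := IH (CkW Hf).
apply: CkM => //; first by apply: CkM => //; [exact: Ck_cst|apply: CkD => //; exact: Ck_cst].
apply: Ck_inv => //.
  by move=> p Up; have := kappa_gt0 (f0 _ Up) => ?; rewrite gt_eqF//; lra.
by apply: CkD => //; [apply: CkM => //; exact: Ck_cst|exact: Ck_cst].
Qed.

End kappa.

(** * Coordinates in dimension three *)

Section vec3.
Context {R : realType}.

Definition i2 : 'I_3 := ord_max.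

Lemma ord3_ind (P : 'I_3 -> Prop) : P 0 -> P 1 -> P i2 -> forall i, P i.
Proof.
move=> P0 P1 P2 [[|[|[|//]]] Hi].
- by rewrite (_ : Ordinal Hi = 0)//; exact/val_inj.
- by rewrite (_ : Ordinal Hi = 1)//; exact/val_inj.
- by rewrite (_ : Ordinal Hi = i2)//; exact/val_inj.
Qed.

Lemma sum3 (V : nmodType) (F : 'I_3 -> V) : \sum_i F i = F 0 + F 1 + F i2.
Proof.
rewrite !big_ord_recl big_ord0 addr0 addrA; congr (_ + _ + _); congr F; exact/val_inj.
Qed.

Lemma vec3_0 (x y z : R) : vec3 x y z 0 0 = x. Proof. by rewrite mxE. Qed.
Lemma vec3_1 (x y z : R) : vec3 x y z 1 0 = y. Proof. by rewrite mxE. Qed.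
Lemma vec3_2 (x y z : R) : vec3 x y z i2 0 = z. Proof. by rewrite mxE. Qed.
Definition vec3E := (vec3_0, vec3_1, vec3_2).

Lemma cV3P (v w : 'cV[R]_3) :
  v 0 0 = w 0 0 -> v 1 0 = w 1 0 -> v i2 0 = w i2 0 -> v = w.
Proof. by move=> H0 H1 H2; apply/colP; elim/ord3_ind. Qed.

Lemma vec3_eta (v : 'cV[R]_3) : v = vec3 (v 0 0) (v 1 0) (v i2 0).
Proof. by apply: cV3P; rewrite vec3E. Qed.

Lemma det3 (A : 'M[R]_3) : \det A =
  A 0 0 * (A 1 1 * A i2 i2 - A 1 i2 * A i2 1)
  - A 0 1 * (A 1 0 * A i2 i2 - A 1 i2 * A i2 0)
  + A 0 i2 * (A 1 0 * A i2 1 - A 1 1 * A i2 0).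
Proof.
(* Indexing entries by natural numbers lets the lifted ordinals of the cofactor expansion reduce by
   computation. *)
pose f (i j : nat) := A (inord i) (inord j).
have E i j : A i j = f i j by rewrite /f !inord_val.
rewrite (expand_det_row A 0) sum3 /cofactor.
rewrite !(expand_det_row _ (0 : 'I_2)) !big_ord_recl !big_ord0 /cofactor !det_mx11 !mxE.
rewrite !E /= /bump /= !expr0 !expr1.
ring.
Qed.

End vec3.

(** * Geometry of the exponential cone *)

Section exp_cone.
Context {R : realType}.
Implicit Types v p : 'cV[R]_3.

Local Notation X v := (v 0 0).
Local Notation Y v := (v 1 0).
Local Notation Z v := (v i2 0).

(* The tangent lines of exp turn the cone into an intersection of half-spaces. *)
Lemma exp_coneP v : exp_cone v <->
  0 <= Z v /\ forall a, expR a * (Z v + X v - a * Z v) <= Y v.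
Proof.
split.
  case=> [[x [y [-> x0 y0]]]|[x [y [z [-> H z0]]]]]; rewrite !vec3E.
    split=> // a; rewrite add0r mulr0 subr0.
    by apply: le_trans y0; rewrite mulr_ge0_le0// expR_ge0.
  split=> [|a]; first exact: ltW.
  have E : z + x - a * z = z * (1 + (x / z - a)) by field; rewrite gt_eqF.
  rewrite E mulrCA.
  have H2 : expR (x / z) * z <= y by rewrite -ler_pdivlMr.
  apply: le_trans H2; rewrite [leRHS]mulrC ler_pM2l//.
  have -> : x / z = a + (x / z - a) by ring.
  rewrite expRD ler_pM2l ?expR_gt0//.
  have -> : a + (x / z - a) - a = x / z - a by ring.
  exact: expR_ge1Dx.
case=> z0 H; rewrite (vec3_eta v).
move: (X v) (Y v) (Z v) z0 H => x y z z0 H {v}.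
move: z0; rewrite le_eqVlt => /orP[/eqP z0|z0]; last first.
  right; exists x, y, z; split=> //.
  have := H (x / z); rewrite divfK ?gt_eqF// addrK => H1.
  by rewrite ler_pdivlMr.
left; exists x, y; rewrite -z0.
(* On the face z = 0 only exp(a) x <= y remains, for all a. If x > 0, the choice exp(a) x = |y| + 1
   violates it. If y < 0, then x < 0, and the choice exp(a) x = y / 2 > y violates it. *)
have {}H a : expR a * x <= y by have := H a; rewrite -z0 add0r mulr0 subr0.
split=> //.
  rewrite leNgt; apply/negP => x0.
  have y0 : 0 < (`|y| + 1) / x by rewrite divr_gt0// ltr_pwDr.
  have := H (ln ((`|y| + 1) / x)); rewrite lnK ?posrE// divfK ?gt_eqF//.
  have := ler_norm y; lra.
rewrite leNgt; apply/negP => y0.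
have x0 : x < 0.
  rewrite ltNge; apply/negP => x0.
  have := H 0; rewrite expR0 mul1r; lra.
have c0 : 0 < y / x / 2.
  by rewrite divr_gt0// -[y / x]mulrNN -invrN divr_gt0// oppr_gt0.
have := H (ln (y / x / 2)); rewrite lnK ?posrE//.
have -> : y / x / 2 * x = y / 2 by field; rewrite lt_eqF.
lra.
Qed.

Definition exp_cone_int : set 'cV[R]_3 :=
  [set v | 0 < Z v /\ Z v * expR (X v / Z v) < Y v].

Lemma open_exp_cone_int : open exp_cone_int.
Proof.
rewrite openE => p [z0 H]; rewrite /interior.
have cX : {for p, continuous (fun v => X v : R^o)} by exact: coord_continuous.
have cY : {for p, continuous (fun v => Y v : R^o)} by exact: coord_continuous.
have cZ : {for p, continuous (fun v => Z v : R^o)} by exact: coord_continuous.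
have cE : {for p, continuous (fun v => Z v * expR (X v / Z v) - Y v : R^o)}.
  apply: (@continuousB _ R^o _ (fun v => Z v * expR (X v / Z v) : R^o) (fun v => Y v : R^o)) => //.
  apply: (@continuousM _ _ (fun v => Z v : R) (fun v => expR (X v / Z v))) => //.
  apply: continuous_comp; last exact: continuous_expR.
  apply: (@continuousM _ _ (fun v => X v : R) (fun v => (Z v)^-1)) => //.
  by apply: (@continuousV _ _ (fun v => Z v : R)) => //; rewrite gt_eqF.
apply: filterI; first exact: (cvgr_gt _ cZ).
have E0 : Z p * expR (X p / Z p) - Y p < 0 by rewrite subr_lt0.
have : \forall v \near (p : 'cV[R]_3), Z (v : 'cV[R]_3) * expR (X v / Z v) - Y v < 0.
  exact: (cvgr_lt _ cE).
by apply: (@filterS _ (nbhs p)) => v; rewrite subr_lt0.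
Qed.

Lemma exp_cone_int_sub v : exp_cone_int v -> exp_cone v.
Proof.
case=> z0 H; right; exists (X v), (Y v), (Z v); split=> //; first exact: vec3_eta.
by rewrite ler_pdivlMr// mulrC ltW.
Qed.

Lemma interior_exp_cone : (@exp_cone R)° = exp_cone_int.
Proof.
apply/seteqP; split=> [p|].
  case/nbhs_normP => r /= r0 Hr.
  (* Stepping back by r / 2 in the z and y directions stays in the cone and turns its weak
     inequalities at p into strict ones. *)
  have mv i : exp_cone (p - (r / 2) *: delta_mx i 0).
    apply: Hr; rewrite /ball_/= opprB addrC subrK normrZ gtr0_norm ?divr_gt0//.
    apply: (@le_lt_trans _ _ (r / 2)); last lra.
    by rewrite -[leRHS]mulr1 ler_pM2l ?divr_gt0// norm_evec.
  have [z0 _] := (exp_coneP _).1 (mv i2).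
  have [_ H1] := (exp_coneP _).1 (mv 1).
  move: z0 H1; rewrite !mxE /= !mulr1 ?mulr0 ?subr0 => z0 H.
  have z1 : 0 < Z p by lra.
  split=> //; have := H (X p / Z p).
  rewrite ?mulr0 ?subr0 divfK ?gt_eqF// addrK mulrC; lra.
rewrite -open_subsetE; first exact: exp_cone_int_sub.
exact: open_exp_cone_int.
Qed.

Lemma exp_cone_int_Y v : exp_cone_int v -> 0 < Y v.
Proof. by case=> z0; apply: lt_trans; rewrite mulr_gt0// expR_gt0. Qed.

Lemma exp_cone_Y v : exp_cone v -> 0 <= Y v.
Proof.
case=> [[x [y [-> x0 y0]]]|[x [y [z [-> H z0]]]]]; rewrite vec3E//.
by have := le_trans (expR_ge0 _) H; rewrite pmulr_lge0// invr_gt0.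
Qed.

Lemma half_space_closed (a b c : R) :
  closed [set v : 'cV[R]_3 | 0 <= a * X v + b * Y v + c * Z v].
Proof.
have C : continuous (fun v => a * X v + b * Y v + c * Z v : R^o).
  move=> p.
  apply: (@continuousD _ R^o _ (fun v => a * X v + b * Y v : R^o) (fun v => c * Z v : R^o)).
    apply: (@continuousD _ R^o _ (fun v => a * X v : R^o) (fun v => b * Y v : R^o)).
      by apply: (@continuousM _ _ (cst a) (fun v => X v : R));
        [exact: cst_continuous|exact: coord_continuous].
    by apply: (@continuousM _ _ (cst b) (fun v => Y v : R));
      [exact: cst_continuous|exact: coord_continuous].
  by apply: (@continuousM _ _ (cst c) (fun v => Z v : R));
    [exact: cst_continuous|exact: coord_continuous].
exact: (closed_comp (fun x _ => C x) (@closed_ge _ 0)).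
Qed.

Lemma line_ge0_slope0 (a b : R) : (forall t, 0 <= a + t * b) -> b = 0.
Proof.
move=> H; apply/eqP/negPn/negP => b0.
have := H (- (a + 1) / b); rewrite divfK//; lra.
Qed.

Lemma regular_exp_cone : regular_cone (@exp_cone R).
Proof.
split.
- move=> a b x y a0 b0 /exp_coneP[x2 Hx] /exp_coneP[y2 Hy]; apply/exp_coneP.
  rewrite !mxE; split=> [|c]; first by rewrite addr_ge0// mulr_ge0.
  have := ler_wpM2l a0 (Hx c); have := ler_wpM2l b0 (Hy c); lra.
- have -> : @exp_cone R = [set v | 0 <= 0 * X v + 0 * Y v + 1 * Z v] `&`
      \bigcap_a [set v | 0 <= - expR a * X v + 1 * Y v + (expR a * (a - 1)) * Z v].
    apply/seteqP; split=> v.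
      move=> /exp_coneP[z0 H]; split=> [/=|a _ /=]; first by lra.
      by have := H a; lra.
    move=> [/= z0 H]; apply/exp_coneP; split=> [|a]; first by lra.
    by have := H a I; rewrite /=; lra.
  apply: closedI; first exact: half_space_closed.
  by apply: closed_bigI => a _; exact: half_space_closed.
- exists (vec3 0 2 1); rewrite interior_exp_cone.
  by split; rewrite !vec3E// mul0r expR0; lra.
(* A line in the cone lies in every half-space of [exp_coneP], so its direction annihilates each
   defining functional; z and the tangents at a = 0 and a = 1 already force v = 0. *)
- move=> [p [v [/eqP v0 H]]]; apply: v0.
  have Hz : Z v = 0.
    apply: (@line_ge0_slope0 (Z p)) => t.
    by have /exp_coneP[+ _] := H t; rewrite !mxE.
  have Hy a : Y v - expR a * X v = 0.
    apply: (@line_ge0_slope0 (Y p - expR a * (Z p + X p - a * Z p))) => t.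
    have /exp_coneP[_ /(_ a)] := H t; rewrite !mxE Hz; lra.
  have H0 := Hy 0; have H1 := Hy 1; rewrite expR0 mul1r in H0.
  have e1 : expR 1 - 1 != 0 :> R by rewrite subr_eq0 gt_eqF// expR_gt1.
  have : (expR 1 - 1) * X v = 0 by lra.
  move/eqP; rewrite mulf_eq0 (negbTE e1) => /eqP HX.
  by apply: cV3P; rewrite !mxE// ; lra.
Qed.

(** It equals (y - x - z) + y + 2 z, a sum of three terms that are nonnegative on the cone (the
    first by the tangent at 0) and vanish together only at the origin. *)
Definition cone_functional : 'rV[R]_3 := \row_i [:: -1; 2; 1]`_i.

Lemma cone_functional_gt0 v : exp_cone v -> v != 0 ->
  0 < (cone_functional *m v) 0 0.
Proof.
move=> Kv v0; rewrite mxE sum3 !mxE/=.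
have y0 := exp_cone_Y Kv; have /exp_coneP[z0 /(_ 0)] := Kv.
rewrite expR0 mul1r mul0r subr0 => H.
rewrite lt_neqAle; apply/andP; split; last by lra.
apply: contra v0 => /eqP E; apply/eqP; apply: cV3P; rewrite !mxE; lra.
Qed.

End exp_cone.

(** * The explicit potential and its Hessian *)

Section potential.
Context {R : realType}.
Implicit Types v w p : 'cV[R]_3.

Local Notation X v := (v 0 0).
Local Notation Y v := (v 1 0).
Local Notation Z v := (v i2 0).

Definition height v : R := ln (Y v) - ln (Z v) - X v / Z v.

(** The last two terms are phi(u): as a function of u they have derivative - 1 / kappa. *)
Definition potential v : R :=
  - ln (Y v) - 2 * ln (Z v) + ln (1 + kappa (height v)) / 2
  - 3 / 2 * ln (kappa (height v)).

Lemma height_gt0 v : exp_cone_int v -> 0 < height v.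
Proof.
move=> Dv; have [z0 H] := Dv; have y0 := exp_cone_int_Y Dv.
rewrite /height -addrA -opprD subr_gt0 -ltr_expR expRD !lnK ?posrE//.
Qed.

Lemma heightE v : exp_cone_int v -> expR (height v) = Y v / Z v / expR (X v / Z v).
Proof.
move=> Dv; have [z0 H] := Dv; have y0 := exp_cone_int_Y Dv.
by rewrite /height !expRB !lnK ?posrE.
Qed.

Definition dheight w p : R := Y w / Y p - Z w / Z p - X w / Z p + X p * Z w / Z p ^+ 2.

Lemma is_derive_height w p : exp_cone_int p -> is_derive p w height (dheight w p).
Proof.
move=> Dp; have [z0 _] := Dp; have y0 := exp_cone_int_Y Dp.
have dX := is_derive_coord p w 0 0.
have dY := is_derive_coord p w 1 0.
have dZ := is_derive_coord p w i2 0.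
have z1 : Z p != 0 by rewrite gt_eqF.
have H := dir_B (dir_B (dir_ln y0 dY) (dir_ln z0 dZ)) (dir_M dX (dir_V z1 dZ)).
by apply: (is_derive_eq H); rewrite /dheight; field; rewrite z1 gt_eqF.
Qed.

Definition dpotential w p : R :=
  - (Y w / Y p) - 2 * (Z w / Z p) - dheight w p / kappa (height p).

Lemma is_derive_potential w p : exp_cone_int p ->
  is_derive p w potential (dpotential w p).
Proof.
move=> Dp; have [z0 _] := Dp; have y0 := exp_cone_int_Y Dp.
have dY := is_derive_coord p w 1 0.
have dZ := is_derive_coord p w i2 0.
have h0 := height_gt0 Dp; have k0 := kappa_gt0 h0.
have dk := is_derive_comp_real (is_derive_height w Dp) (is_derive_kappa h0).
have k1 : 0 < 1 + kappa (height p) by lra.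
have H := dir_B (dir_D (dir_B (dir_N (dir_ln y0 dY))
   (dir_M (dir_cst p w 2) (dir_ln z0 dZ)))
   (dir_M (dir_ln (f := fun x => 1 + kappa (height x)) k1
     (dir_D (dir_cst p w 1) dk)) (dir_cst p w 2^-1)))
   (dir_M (dir_cst p w (3 / 2)) (dir_ln (f := fun x => kappa (height x)) k0 dk)).
apply: (is_derive_eq H); rewrite /dpotential /dkappa.
field; rewrite !gt_eqF//; lra.
Qed.

(** The bracket over k is the second derivative of [height]; the last coefficient is [dkappa] /
    kappa^2, from differentiating 1 / kappa. *)
Definition hess_form w' w p : R :=
  let k := kappa (height p) in
  Y w * Y w' / Y p ^+ 2 + 2 * Z w * Z w' / Z p ^+ 2
  - (- (Y w * Y w' / Y p ^+ 2) + Z w * Z w' / Z p ^+ 2 + X w * Z w' / Z p ^+ 2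
     + X w' * Z w / Z p ^+ 2 - 2 * X p * Z w * Z w' / Z p ^+ 3) / k
  + 2 * (1 + k) / (k ^+ 2 * (2 * k + 3)) * dheight w p * dheight w' p.

Lemma is_derive_dpotential w w' p : exp_cone_int p ->
  is_derive p w' (dpotential w) (hess_form w' w p).
Proof.
move=> Dp; have [z0 _] := Dp; have y0 := exp_cone_int_Y Dp.
have dX := is_derive_coord p w' 0 0.
have dY := is_derive_coord p w' 1 0.
have dZ := is_derive_coord p w' i2 0.
have h0 := height_gt0 Dp; have k0 := kappa_gt0 h0.
have z1 : Z p != 0 by rewrite gt_eqF.
have y1 : Y p != 0 by rewrite gt_eqF.
have k1 : kappa (height p) != 0 by rewrite gt_eqF.
have z2 : Z p ^+ 2 != 0 by rewrite expf_neq0.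
have dk := is_derive_comp_real (is_derive_height w' Dp) (is_derive_kappa h0).
have c' := dir_cst p w'.
have dYV := dir_V y1 dY; have dZV := dir_V z1 dZ.
have dZ2 : is_derive p w' (fun v => (Z v ^+ 2)^-1) (- 2 * Z w' / Z p ^+ 3).
  have := dir_M dZV dZV => H.
  have E : (fun v => (Z v ^+ 2)^-1) = (fun x => (Z x)^-1 * (Z x)^-1).
    by apply/funext => x; rewrite expr2 invfM.
  by rewrite E; apply: (is_derive_eq H); field.
have ddh := dir_D (dir_B (dir_B (dir_M (c' (Y w)) dYV) (dir_M (c' (Z w)) dZV))
    (dir_M (c' (X w)) dZV)) (dir_M (dir_M dX (c' (Z w))) dZ2).
have H := dir_B (dir_B (dir_N (dir_M (c' (Y w)) dYV))
    (dir_M (c' 2) (dir_M (c' (Z w)) dZV)))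
   (dir_M ddh (dir_V (f := fun x => kappa (height x)) k1 dk)).
apply: (is_derive_eq H); rewrite /hess_form /dheight /dkappa.
field; rewrite z1 y1 k1 gt_eqF//; lra.
Qed.

Lemma partial_potential i p : exp_cone_int p ->
  partial i (potential : _ -> R^o) p = dpotential (delta_mx i 0) p.
Proof. by move=> /(is_derive_potential (delta_mx i 0))[_ <-]. Qed.

Lemma hessian_potential p : exp_cone_int p ->
  hessian potential p =
  \matrix_(i, j) hess_form (delta_mx i 0) (delta_mx j 0) p.
Proof.
move=> Dp; apply/matrixP => i j; rewrite !mxE.
rewrite (@eq_on_open_partial _ _ exp_cone_int _ (dpotential (delta_mx j 0)))//.
- by have [_ <-] := is_derive_dpotential (delta_mx j 0) (delta_mx i 0) Dp.
- exact: open_exp_cone_int.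
- by move=> q Dq; rewrite partial_potential.
Qed.

Lemma det_hessian_potential p : exp_cone_int p ->
  \det (hessian potential p) = expR (2 * potential p).
Proof.
move=> Dp; have [z0 _] := Dp; have y0 := exp_cone_int_Y Dp.
have h0 := height_gt0 Dp; have k0 := kappa_gt0 h0.
(* Clearing logarithms leaves a rational identity in x, y, z and kappa, which [field] decides. *)
have -> : expR (2 * potential p) =
    (1 + kappa (height p)) / (kappa (height p) ^+ 3 * Y p ^+ 2 * Z p ^+ 4).
  have k1 : 0 < 1 + kappa (height p) by lra.
  have -> : 2 * potential p = ln (1 + kappa (height p)) - (ln (kappa (height p)) *+ 3
      + ln (Y p) *+ 2 + ln (Z p) *+ 4) by rewrite /potential; field.
  rewrite -!lnXn// expRB lnK ?posrE// !expRD.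
  by rewrite !lnK ?posrE ?exprn_gt0.
rewrite hessian_potential// det3 !mxE /hess_form /dheight !mxE /=.
field; rewrite !gt_eqF//; lra.
Qed.

Lemma qform_hessian_potential p v : exp_cone_int p ->
  qform (hessian potential p) v = hess_form v v p.
Proof.
move=> Dp; have [z0 _] := Dp; have y0 := exp_cone_int_Y Dp.
have h0 := height_gt0 Dp; have k0 := kappa_gt0 h0.
rewrite /qform hessian_potential// !mxE sum3 !mxE !sum3 !mxE.
rewrite /hess_form /dheight !mxE /=.
field; rewrite !gt_eqF//; lra.
Qed.

Lemma posdef_hessian_potential p : exp_cone_int p -> posdef (hessian potential p).
Proof.
move=> Dp; have [z0 _] := Dp; have y0 := exp_cone_int_Y Dp.
have h0 := height_gt0 Dp; have k0 := kappa_gt0 h0.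
split.
  rewrite hessian_potential//; apply/matrixP => i j; rewrite !mxE /hess_form.
  by ring.
move=> v v0; rewrite -/(qform _ _) qform_hessian_potential//.
set k := kappa (height p) in k0 *.
(* a, b, c are the coordinates of v in the frame z e_x, y e_y, x e_x + z e_z. *)
pose b := Y v / Y p; pose c := Z v / Z p; pose a := X v / Z p - X p * Z v / Z p ^+ 2.
pose m := 2 * (1 + k) / (k ^+ 2 * (2 * k + 3)).
have m0 : 0 < m by rewrite /m; apply: divr_gt0; [lra|rewrite mulr_gt0 ?exprn_gt0//; lra].
(* Squares are completed successively in a, b and c. The combination a - b + c is minus the
   derivative of [height] along v, which explains the shape of the first square. *)
have E : hess_form v v p = m * (a - b + c - c / k / m) ^+ 2
    + (1 + k^-1) * (b - c / (1 + k)) ^+ 2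
    + (2 * k + 3) / (2 * (1 + k)) * c ^+ 2.
  rewrite /hess_form /dheight -/k /m /a /b /c.
  field; rewrite !gt_eqF//; lra.
have k1 : 0 < 1 + k^-1 by rewrite addr_gt0// invr_gt0.
have k2 : 0 < (2 * k + 3) / (2 * (1 + k)) by apply: divr_gt0; lra.
have S1 : 0 <= m * (a - b + c - c / k / m) ^+ 2 by rewrite mulr_ge0 ?sqr_ge0// ltW.
have S2 : 0 <= (1 + k^-1) * (b - c / (1 + k)) ^+ 2 by rewrite mulr_ge0 ?sqr_ge0// ltW.
have S3 : 0 <= (2 * k + 3) / (2 * (1 + k)) * c ^+ 2 by rewrite mulr_ge0 ?sqr_ge0// ltW.
rewrite lt_neqAle E; apply/andP; split; last by rewrite !addr_ge0.
apply: contra v0; rewrite eq_sym paddr_eq0 ?addr_ge0// paddr_eq0//.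
have sq0 (d x : R) : 0 < d -> d * x ^+ 2 == 0 -> x = 0.
  by move=> d0; rewrite mulf_eq0 gt_eqF//= sqrf_eq0 => /eqP.
move=> /andP[/andP[/(sq0 _ _ m0) ab /(sq0 _ _ k1) b0] /(sq0 _ _ k2) c0].
move: ab b0; rewrite c0 !mul0r !subr0 addr0 => ab b0.
move: ab; rewrite b0 subr0 => a0.
have Zv : Z v = 0 by move/eqP: c0; rewrite mulf_eq0 invr_eq0 (gt_eqF z0) orbF => /eqP.
have Yv : Y v = 0 by move/eqP: b0; rewrite mulf_eq0 invr_eq0 (gt_eqF y0) orbF => /eqP.
have Xv : X v = 0.
  move: a0; rewrite /a Zv mulr0 mul0r subr0 => /eqP.
  by rewrite mulf_eq0 invr_eq0 (gt_eqF z0) orbF => /eqP.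
by apply/eqP; apply: cV3P; rewrite !mxE.
Qed.

Lemma potential_smooth : smooth_on exp_cone_int (potential : _ -> R^o).
Proof.
apply/smooth_onP => k; have oD := @open_exp_cone_int R.
have CX : Ck exp_cone_int k (fun v => X v : R^o) by exact: Ck_coord.
have CY : Ck exp_cone_int k (fun v => Y v : R^o) by exact: Ck_coord.
have CZ : Ck exp_cone_int k (fun v => Z v : R^o) by exact: Ck_coord.
have ClY : Ck exp_cone_int k (fun v => ln (Y v) : R^o).
  by apply: Ck_ln => // p /exp_cone_int_Y.
have ClZ : Ck exp_cone_int k (fun v => ln (Z v) : R^o).
  by apply: Ck_ln => // p [].
have Ch : Ck exp_cone_int k (height : _ -> R^o).
  apply: CkB => //; first exact: CkB.
  apply: CkM => //; apply: Ck_inv => // p [z0 _]; by rewrite gt_eqF.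
have Ckap : Ck exp_cone_int k (fun v => kappa (height v) : R^o).
  by apply: Ck_kappa => // p; exact: height_gt0.
have kap0 p : exp_cone_int p -> 0 < kappa (height p).
  by move=> /height_gt0/kappa_gt0.
have cst c : Ck exp_cone_int k (fun=> c : R^o) by exact: Ck_cst.
apply: CkB => //.
  apply: CkD => //.
    by apply: CkB => //; [exact: CkN|exact: CkM].
  apply: CkM => //; apply: Ck_ln => //.
    by move=> p /kap0; lra.
  exact: CkD.
by apply: CkM => //; exact: Ck_ln.
Qed.

Lemma heightZ t v : 0 < t -> exp_cone_int v -> height (t *: v) = height v.
Proof.
move=> t0 Dv; have [z0 _] := Dv; have y0 := exp_cone_int_Y Dv.
rewrite /height !mxE !lnM ?posrE//.
have -> : t * X v / (t * Z v) = X v / Z v by field; rewrite !gt_eqF.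
ring.
Qed.

Lemma potentialZ t v : 0 < t -> exp_cone_int v ->
  potential (t *: v) = potential v - 3%:R * ln t.
Proof.
move=> t0 Dv; have [z0 _] := Dv; have y0 := exp_cone_int_Y Dv.
rewrite /potential heightZ// !mxE !lnM ?posrE//; ring.
Qed.

(* z * height is the distance to the boundary in the x direction. *)
Lemma expRN_potential_le v : exp_cone_int v ->
  expR (- potential v) <= Y v * Z v * (Z v * height v).
Proof.
move=> Dv; have [z0 _] := Dv; have y0 := exp_cone_int_Y Dv.
have h0 := height_gt0 Dv; have k0 := kappa_gt0 h0.
have kh := kappa_le h0.
set k := kappa (height v) in k0 kh *; set h := height v in h0 kh *.
(* exp(- F) is y z^2 k^(3/2) (1 + k)^(-1/2); the bounds k <= 1 + k and k <= h reduce it to y z^2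
   h. *)
have l1 : ln k <= ln (1 + k) by rewrite ler_ln ?posrE; lra.
have -> : Y v * Z v * (Z v * h) = expR (ln (Y v) + ln (Z v) *+ 2 + ln h).
  by rewrite -lnXn// !expRD !lnK ?posrE ?exprn_gt0//; ring.
have l2 : ln k <= ln h by rewrite ler_ln ?posrE.
rewrite ler_expR /potential -/h -/k; lra.
Qed.

(** By [expRN_potential_le] it suffices that y z (z h) tends to 0. At boundary points with z > 0 the
    height h vanishes and continuity suffices; on the face z = 0, h itself may be unbounded, but z h
    is not. *)
Lemma potential_boundary p : closure (@exp_cone R) p -> ~ (@exp_cone R)° p ->
  potential x @[x --> within (@exp_cone R)° (nbhs p)] --> +oo.
Proof.
rewrite interior_exp_cone => Kp nDp.
have {}Kp : exp_cone p by case: (@regular_exp_cone R) => _ cK _ _; exact: cK.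
have y0 := exp_cone_Y Kp; have [z0 Hp] := (exp_coneP p).1 Kp.
have cX : {for p, continuous (fun v => X v : R^o)} by exact: coord_continuous.
have cY : {for p, continuous (fun v => Y v : R^o)} by exact: coord_continuous.
have cZ : {for p, continuous (fun v => Z v : R^o)} by exact: coord_continuous.
suff H : forall e : R, 0 < e -> \forall x \near p, exp_cone_int x ->
    Y x * Z x * (Z x * height x) < e.
  apply/cvgryPge => A; rewrite near_withinE.
  have := H (expR (- A)) (expR_gt0 _).
  apply: (@filterS _ (nbhs p)) => x Hx Dx.
  rewrite -lerN2 -ler_expR; apply: le_trans (expRN_potential_le Dx) _.
  exact/ltW/Hx.
move=> e e0.
move: z0; rewrite le_eqVlt => /orP[/eqP z0|z0].
  (* A local bound for y (z h): from ln r < r, z h = z ln (y / z) - x <= y - x. The remaining factor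
     z tends to 0. *)
  pose M := (`|Y p| + 1) * (`|Y p| + 1 + `|X p| + 1).
  have M0 : 0 < M.
    have := normr_ge0 (Y p); have := normr_ge0 (X p) => ? ?.
    by apply: mulr_gt0; lra.
  near=> x => Dx; have [zx _] := Dx; have yx := exp_cone_int_Y Dx.
  have Yx : Y x < `|Y p| + 1.
    near: x; apply: (cvgr_lt _ cY); have := ler_norm (Y p); lra.
  have Xx : - (`|X p| + 1) < X x.
    near: x; apply: (cvgr_gt _ cX); have := ler_norm (- X p); rewrite normrN; lra.
  have Zx : Z x < e / M.
    by near: x; apply: (cvgr_lt _ cZ); rewrite -z0 divr_gt0.
  have w : Z x * height x <= `|Y p| + 1 + `|X p| + 1.
    have -> : Z x * height x = Z x * ln (Y x / Z x) - X x.
      by rewrite /height ln_div ?posrE//; field; rewrite gt_eqF.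
    have : Z x * ln (Y x / Z x) <= Y x.
      have E : Y x = Z x * (Y x / Z x) by field; rewrite gt_eqF.
      rewrite [leRHS]E.
      by rewrite ler_pM2l// ltW// ln_sublinear// divr_gt0.
    lra.
  have zh : 0 <= Z x * height x by rewrite mulr_ge0 ?ltW// height_gt0.
  rewrite mulrAC; apply: (@le_lt_trans _ _ (M * Z x)).
    by rewrite ler_pM2r//; apply: ler_pM => //; exact: ltW.
  by rewrite mulrC -ltr_pdivlMr.
have H1 : Y p = Z p * expR (X p / Z p).
  apply/eqP; rewrite eq_le; apply/andP; split.
    by rewrite leNgt; apply/negP => H; apply: nDp.
  by have := Hp (X p / Z p); rewrite divfK ?gt_eqF// addrK mulrC.
have yp : 0 < Y p by rewrite H1 mulr_gt0 ?expR_gt0.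
have hp : height p = 0.
  by rewrite /height H1 lnM ?posrE ?expR_gt0// expRK; ring.
have ch : {for p, continuous (fun v => Y v * Z v * (Z v * height v) : R^o)}.
  apply: (@continuousM _ _ (fun v => Y v * Z v : R) (fun v => Z v * height v)).
    by apply: (@continuousM _ _ (fun v => Y v : R) (fun v => Z v : R)).
  apply: (@continuousM _ _ (fun v => Z v : R) height) => //.
  apply: (@continuousB _ R^o _ (fun v => ln (Y v) - ln (Z v) : R^o) (fun v => X v / Z v : R^o)).
    apply: (@continuousB _ R^o _ (fun v => ln (Y v) : R^o) (fun v => ln (Z v) : R^o)).
      by apply: continuous_comp => //; exact: continuous_ln.
    by apply: continuous_comp => //; exact: continuous_ln.
  apply: (@continuousM _ _ (fun v => X v : R) (fun v => (Z v)^-1)) => //.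
  by apply: (@continuousV _ _ (fun v => Z v : R)) => //; rewrite gt_eqF.
have : \forall x \near p, Y (x : 'cV[R]_3) * Z x * (Z x * height x) < e.
  by apply: (cvgr_lt _ ch); rewrite hp !mulr0.
by apply: (@filterS _ (nbhs p)) => x.
Unshelve. all: by end_near. Qed.

Theorem canonical_potential_exp_cone : canonical_potential (@exp_cone R) potential.
Proof.
split; first exact: regular_exp_cone.
  split; rewrite ?interior_exp_cone.
  - exact: potential_smooth.
  - exact: posdef_hessian_potential.
  - exact: det_hessian_potential.
  - by rewrite -interior_exp_cone; exact: potential_boundary.
by rewrite interior_exp_cone => t x; exact: potentialZ.
Qed.

Lemma canonical_potential_exp_coneE F : canonical_potential (@exp_cone R) F ->
  forall v, exp_cone_int v -> F v = potential v.
Proof.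
move=> HF v; rewrite -interior_exp_cone => Dv.
apply: (canonical_potential_unique (e := vec3 0 2 1) (l := cone_functional) HF
  canonical_potential_exp_cone) => //.
- by rewrite interior_exp_cone; split; rewrite !vec3E// mul0r expR0; lra.
- exact: cone_functional_gt0.
Qed.

End potential.

(** * The affine sphere *)

Section level_set_parametrization.
Context {R : realType}.

Local Notation X v := (v 0 0).
Local Notation Y v := (v 1 0).
Local Notation Z v := (v i2 0).

Lemma exp_cone_intP (v : 'cV[R]_3) :
  0 < Y v -> 0 < Z v -> 0 < height v -> exp_cone_int v.
Proof.
move=> y0 z0; rewrite /height -addrA -opprD subr_gt0 => H; split=> //.
by rewrite -[ltRHS]lnK ?posrE// -{1}[Z v]lnK ?posrE// -expRD ltr_expR.
Qed.

Definition zero_level : set 'cV[R]_3 :=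
  [set v | exp_cone_int v /\ potential v = 0].

Lemma vec2E (a b : R) : (vec2 a b 0 0 = a) * (vec2 a b 1 0 = b).
Proof. by rewrite !mxE. Qed.

Lemma vec2_eta (p : 'cV[R]_2) : p = vec2 (p 0 0) (p 1 0).
Proof.
apply/colP => -[[|[|//]]] Hi; rewrite mxE /=; congr (p _ _); exact/val_inj.
Qed.

Lemma quadrantE (p : 'cV[R]_2) : quadrant p <-> 0 < p 0 0 /\ 0 < p 1 0.
Proof.
split=> [[k [z [-> k0 z0]]]|[k0 z0]]; first by rewrite !vec2E.
by exists (p 0 0), (p 1 0); split=> //; exact: vec2_eta.
Qed.

Lemma ln_sphere_Y (k z : R) : 0 < k -> 0 < z ->
  ln (z ^- 2 * k `^ (- (3 / 2)) * Num.sqrt (1 + k)) =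
  - 2 * ln z - 3 / 2 * ln k + ln (1 + k) / 2.
Proof.
move=> k0 z0; have k1 : 0 < 1 + k by lra.
have p0 : 0 < k `^ (- (3 / 2)) by exact: powR_gt0.
have z2 : 0 < z ^+ 2 by exact: exprn_gt0.
rewrite !lnM ?posrE ?mulr_gt0 ?invr_gt0 ?sqrtr_gt0// lnV ?posrE// lnXn// ln_powR.
by rewrite -powR12_sqrt ?(ltW k1)// ln_powR; ring.
Qed.

Lemma sphere_Y_gt0 (k z : R) : 0 < k -> 0 < z ->
  0 < z ^- 2 * k `^ (- (3 / 2)) * Num.sqrt (1 + k).
Proof.
move=> k0 z0; rewrite !mulr_gt0 ?invr_gt0 ?exprn_gt0 ?powR_gt0 ?sqrtr_gt0//; lra.
Qed.

Lemma height_sphere_param (p : 'cV[R]_2) : quadrant p ->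
  height (sphere_param p) = theta (p 0 0).
Proof.
move=> /quadrantE[k0 z0].
rewrite /height /sphere_param !vec3E ln_sphere_Y// /theta.
by field; rewrite gt_eqF.
Qed.

Lemma sphere_param_zero_level (p : 'cV[R]_2) : quadrant p ->
  zero_level (sphere_param p).
Proof.
move=> qp; have hp := height_sphere_param qp.
have [k0 z0] := (quadrantE p).1 qp.
have Dp : exp_cone_int (sphere_param p).
  apply: exp_cone_intP; rewrite ?hp ?theta_gt0//.
    by rewrite /sphere_param !vec3E sphere_Y_gt0.
  by rewrite /sphere_param !vec3E.
split=> //; rewrite /potential hp kappaK//.
rewrite /sphere_param !vec3E ln_sphere_Y//; by field.
Qed.

(** A point of the level set has parameters [kappa (height v)] and z: the equation F = 0 gives ln y
    in terms of them, and theta(kappa) = u then gives x. *)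
Lemma zero_levelE : zero_level = @sphere_param R @` @quadrant R.
Proof.
apply/seteqP; split=> [v [Dv pv]|_ [p qp <-]]; last exact: sphere_param_zero_level.
have [z0 _] := Dv; have y0 := exp_cone_int_Y Dv.
have h0 := height_gt0 Dv; have k0 := kappa_gt0 h0.
have hk := thetaK h0; move: pv hk; rewrite /potential /theta.
set k := kappa (height v) in k0 *; rewrite /height => pv hk.
exists (vec2 k (Z v)); first by apply/quadrantE; rewrite !vec2E.
rewrite /sphere_param !vec2E; apply: cV3P; rewrite !vec3E//.
- have : Z v * (ln (Y v) - ln (Z v) - X v / Z v) = Z v * (k + ln (1 + k) / 2) by rewrite hk.
  have -> : Z v * (ln (Y v) - ln (Z v) - X v / Z v) = Z v * (ln (Y v) - ln (Z v)) - X v.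
    by field; rewrite gt_eqF.
  have -> : ln (Y v) = - 2 * ln (Z v) + ln (1 + k) / 2 - 3 / 2 * ln k by lra.
  move=> H; lra.
- apply: ln_inj; rewrite ?posrE ?sphere_Y_gt0//.
  by rewrite ln_sphere_Y//; lra.
Qed.

Lemma open_quadrant : open (@quadrant R).
Proof.
rewrite openE => p /quadrantE[k0 z0].
have c0 : {for p, continuous (fun p : 'cV[R]_2 => p 0 0 : R^o)} by exact: coord_continuous.
have c1 : {for p, continuous (fun p : 'cV[R]_2 => p 1 0 : R^o)} by exact: coord_continuous.
have H : \forall q \near (p : 'cV[R]_2), 0 < (q : 'cV[R]_2) 0 0 /\ 0 < q 1 0.
  by apply: filterI; [exact: (cvgr_gt _ c0)|exact: (cvgr_gt _ c1)].
by move: H; apply: (@filterS _ (nbhs p)) => q Hq; exact/quadrantE.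
Qed.

Lemma Ck_vec3 (U : set 'cV[R]_2) k (fx fy fz : 'cV[R]_2 -> R^o) :
  Ck U k fx -> Ck U k fy -> Ck U k fz ->
  forall j, Ck U k (fun p => vec3 (fx p) (fy p) (fz p) j 0 : R^o).
Proof.
move=> Hx Hy Hz; elim/ord3_ind.
- by rewrite (_ : (fun p => _) = fx)//; apply/funext => p; rewrite vec3E.
- by rewrite (_ : (fun p => _) = fy)//; apply/funext => p; rewrite vec3E.
- by rewrite (_ : (fun p => _) = fz)//; apply/funext => p; rewrite vec3E.
Qed.

Lemma Ck_sphere_param k j :
  Ck (@quadrant R) k (fun p => sphere_param p j 0 : R^o).
Proof.
have oq := open_quadrant.
have Ck0 : Ck (@quadrant R) k (fun p => p 0 0 : R^o) by exact: Ck_coord.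
have Cz : Ck (@quadrant R) k (fun p => p 1 0 : R^o) by exact: Ck_coord.
have kp p : @quadrant R p -> 0 < p 0 0 by case/quadrantE.
have zp p : @quadrant R p -> 0 < p 1 0 by case/quadrantE.
have cst c : Ck (@quadrant R) k (fun=> c : R^o) by exact: Ck_cst.
have Clz : Ck (@quadrant R) k (fun p => ln (p 1 0) : R^o) by exact: Ck_ln.
have Clk : Ck (@quadrant R) k (fun p => ln (p 0 0) : R^o) by exact: Ck_ln.
apply: Ck_vec3 => //.
- apply: CkM => //; first exact: CkN.
  apply: CkD => //; apply: CkD => //; exact: CkM.
- apply: CkM => //; first apply: CkM => //.
  + apply: Ck_inv => //; last exact: CkM.
    by move=> p /zp z0; rewrite expf_neq0// gt_eqF.
  + exact: Ck_powR.
  + apply: Ck_sqrt => //; last exact: CkD.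
    by move=> p /kp; lra.
Qed.

Lemma injective_diff (m n : nat) (U : set 'cV[R]_m) (f : 'cV[R]_m -> 'cV[R]_n) p :
  open U -> (forall j, Ck U 1 (fun q => f q j 0 : R^o)) -> U p ->
  (forall w, (forall j, is_derive p w (fun q => f q j 0 : R^o) 0) -> w = 0) ->
  injective ('d f p : 'cV[R]_m -> 'cV[R]_n).
Proof.
move=> oU Hf Up H v w vw; apply/eqP; rewrite -subr_eq0; apply/eqP; apply: H => j.
have [_ E] := vec_differentiable oU Hf Up.
apply: (is_derive_eq (C1_is_derive (v - w) oU (Hf j) Up)).
by rewrite -E linearB/= vw subrr mxE.
Qed.

Lemma cV2P (v w : 'cV[R]_2) : v 0 0 = w 0 0 -> v 1 0 = w 1 0 -> v = w.
Proof. by move=> H0 H1; rewrite (vec2_eta v) (vec2_eta w) H0 H1. Qed.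

Lemma is_derive_unique (m : nat) (f : 'cV[R]_m -> R) p v (a b : R) :
  is_derive p v f a -> is_derive p v f b -> a = b.
Proof. by move=> [_ <-] [_ <-]. Qed.

Lemma immersion_sphere_param : immersion_on (@quadrant R) (@sphere_param R).
Proof.
split; first by apply: vec_smooth_on => [|j k]; [exact: open_quadrant|exact: Ck_sphere_param].
move=> p qp; apply: (injective_diff open_quadrant) => //.
  by move=> j; exact: Ck_sphere_param.
move=> w Hw; have [k0 z0] := (quadrantE p).1 qp.
have d0 := is_derive_coord p w 0 0; have d1 := is_derive_coord p w 1 0.
have w1 : w 1 0 = 0.
  apply: (@is_derive_unique _ (fun q => q 1 0) p w) => //.
  have := Hw i2; rewrite (_ : (fun q => _) = (fun q : 'cV[R]_2 => q 1 0))//.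
  by apply/funext => q; rewrite /sphere_param vec3E.
have H := dir_M (dir_N d1) (dir_D (dir_D (dir_M (dir_cst p w 3) (dir_ln z0 d1))
  (dir_M (dir_cst p w (3 / 2)) (dir_ln k0 d0))) d0).
have H0 := Hw 0; rewrite (_ : (fun q => _) = (fun x : 'cV[R]_2 =>
  - x 1 0 * (3 * ln (x 1 0) + 3 / 2 * ln (x 0 0) + x 0 0))) in H0; last first.
  by apply/funext => q; rewrite /sphere_param vec3E.
have := is_derive_unique H H0; rewrite w1 => E.
apply: cV2P; rewrite !mxE//.
(* Once dz = 0, this is minus the coefficient of dkappa in dx; being nonzero, it forces dkappa =
   0. *)
have c0 : 0 < p 1 0 * (3 / 2 / p 0 0 + 1).
  by rewrite mulr_gt0// addr_gt0// divr_gt0//; lra.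
apply: (mulfI (lt0r_neq0 c0)); rewrite mulr0.
have -> : p 1 0 * (3 / 2 / p 0 0 + 1) * w 0 0 = - (- p 1 0 *
    (3 * (0 / p 1 0) + ln (p 1 0) * 0 + (3 / 2 * (w 0 0 / p 0 0) + ln (p 0 0) * 0) +
     w 0 0) + (3 * ln (p 1 0) + 3 / 2 * ln (p 0 0) + p 0 0) * - 0).
  by field; rewrite !gt_eqF.
by rewrite E oppr0.
Qed.

End level_set_parametrization.

(** * Affine normal and affine metric *)

Section blaschke_chart.
Context {R : realType}.
Implicit Types p w : 'cV[R]_2.

(* Coordinates (ln kappa, ln (z sqrt kappa)) on the sphere: they diagonalize
   the affine metric and make it dominate a multiple of the Euclidean one. *)
Local Notation T p := (p 0 0).
Local Notation S p := (p 1 0).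

Definition ck p : R := expR (T p).
Definition cz p : R := expR (S p - T p / 2).
Definition cy p : R := expR (- 2 * S p - T p / 2) * Num.sqrt (1 + ck p).

(** In these coordinates 3 ln z + (3/2) ln kappa collapses to 3 S. *)
Definition chart p : 'cV[R]_3 := vec3 (- cz p * (3 * S p + ck p)) (cy p) (cz p).

Lemma ck_gt0 p : 0 < ck p. Proof. exact: expR_gt0. Qed.
Lemma cz_gt0 p : 0 < cz p. Proof. exact: expR_gt0. Qed.
Lemma cy_gt0 p : 0 < cy p.
Proof. by rewrite mulr_gt0 ?expR_gt0// sqrtr_gt0; have := ck_gt0 p; lra. Qed.

Lemma chartE p : chart p = sphere_param (vec2 (ck p) (cz p)).
Proof.
rewrite /sphere_param !vec2E /chart; congr vec3.
  by rewrite /cz /ck !expRK; field.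
rewrite /cy -[ck p `^ _]lnK ?posrE ?powR_gt0 ?ck_gt0// ln_powR /cz /ck expRK.
by rewrite -expRM_natl -expRN -expRD; congr (expR _ * _); field.
Qed.

Lemma image_chart : chart @` setT = @zero_level R.
Proof.
rewrite zero_levelE; apply/seteqP; split=> [_ [p _ <-]|_ [p /quadrantE[k0 z0] <-]].
  rewrite chartE; exists (vec2 (ck p) (cz p)) => //.
  by apply/quadrantE; rewrite !vec2E ck_gt0 cz_gt0.
exists (vec2 (ln (p 0 0)) (ln (p 1 0) + ln (p 0 0) / 2)) => //.
rewrite chartE; congr sphere_param.
by rewrite [RHS]vec2_eta /ck /cz !vec2E addrK !lnK.
Qed.

Lemma chart_inj : injective chart.
Proof.
move=> p q; rewrite !chartE => E.
have qd r : quadrant (vec2 (ck r) (cz r)).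
  by apply/quadrantE; rewrite !vec2E ck_gt0 cz_gt0.
have Ek : ck p = ck q.
  have := congr1 (fun v => kappa (height v)) E.
  by rewrite /= !height_sphere_param// !vec2E !kappaK ?ck_gt0.
have Ez : cz p = cz q.
  have := congr1 (fun v : 'cV[R]_3 => v i2 0) E.
  by rewrite /sphere_param !vec3E !vec2E.
have ET : T p = T q by exact: expR_inj Ek.
apply: cV2P => //.
have := expR_inj Ez; rewrite ET; lra.
Qed.

Lemma is_derive_ck w p : is_derive p w ck (T w * ck p).
Proof. exact: dir_expR (is_derive_coord p w 0 0). Qed.

Lemma is_derive_cz w p : is_derive p w cz ((S w - T w / 2) * cz p).
Proof.
have H := dir_expR (dir_B (is_derive_coord p w 1 0)
  (dir_M (is_derive_coord p w 0 0) (dir_cst p w 2^-1))).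
by apply: (is_derive_eq H); rewrite /cz; ring.
Qed.

Lemma is_derive_cy w p :
  is_derive p w cy (cy p * (- 2 * S w - T w / (2 * (1 + ck p)))).
Proof.
have k0 := ck_gt0 p; have k1 : 0 < 1 + ck p by lra.
have H1 := dir_expR (dir_B (dir_M (dir_cst p w (- 2)) (is_derive_coord p w 1 0))
  (dir_M (is_derive_coord p w 0 0) (dir_cst p w 2^-1))).
have H2 := dir_sqrt (f := fun x => 1 + ck x) k1 (dir_D (dir_cst p w 1) (is_derive_ck w p)).
have H := dir_M H1 H2.
apply: (is_derive_eq H); rewrite /cy.
have r0 : 0 < Num.sqrt (1 + ck p) by rewrite sqrtr_gt0.
have E : 1 + ck p = Num.sqrt (1 + ck p) ^+ 2 by rewrite sqr_sqrtr// ltW.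
have -> : ck p = Num.sqrt (1 + ck p) ^+ 2 - 1 by rewrite -E; ring.
rewrite (_ : 1 + (Num.sqrt (1 + ck p) ^+ 2 - 1) = Num.sqrt (1 + ck p) ^+ 2); last by ring.
rewrite sqrtr_sqr ger0_norm ?ltW//.
by field; rewrite gt_eqF.
Qed.

Definition dchart w p : 'cV[R]_3 :=
  vec3 (- cz p * ((S w - T w / 2) * (3 * S p + ck p) + 3 * S w + T w * ck p))
       (cy p * (- 2 * S w - T w / (2 * (1 + ck p))))
       ((S w - T w / 2) * cz p).

Definition ddchart w w' p : 'cV[R]_3 :=
  vec3 (- cz p * ((S w' - T w' / 2) * ((S w - T w / 2) * (3 * S p + ck p) + 3 * S w + T w * ck p)
         + (S w - T w / 2) * (3 * S w' + T w' * ck p) + T w * T w' * ck p))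
       (cy p * ((- 2 * S w - T w / (2 * (1 + ck p))) * (- 2 * S w' - T w' / (2 * (1 + ck p)))
         + T w * T w' * ck p / (2 * (1 + ck p) ^+ 2)))
       ((S w - T w / 2) * (S w' - T w' / 2) * cz p).

Lemma is_derive_vec3 (fx fy fz : 'cV[R]_2 -> R) p w (dx dy dz : R) :
  is_derive p w fx dx -> is_derive p w fy dy -> is_derive p w fz dz ->
  is_derive p w (fun q => vec3 (fx q) (fy q) (fz q)) (vec3 dx dy dz).
Proof.
move=> Hx Hy Hz.
have Ex : (fun q => vec3 (fx q) (fy q) (fz q) 0 0) = fx by apply/funext => q; rewrite vec3E.
have Ey : (fun q => vec3 (fx q) (fy q) (fz q) 1 0) = fy by apply/funext => q; rewrite vec3E.
have Ez : (fun q => vec3 (fx q) (fy q) (fz q) i2 0) = fz by apply/funext => q; rewrite vec3E.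
have D : derivable (fun q => vec3 (fx q) (fy q) (fz q)) p w.
  apply/derivable_mxP => i j; rewrite {j}(ord1 j).
  elim/ord3_ind: i; [rewrite Ex; by case: Hx|rewrite Ey; by case: Hy|rewrite Ez; by case: Hz].
apply: DeriveDef => //; rewrite derive_mx//.
apply: cV3P; rewrite mxE vec3E.
- by rewrite Ex; case: Hx.
- by rewrite Ey; case: Hy.
- by rewrite Ez; case: Hz.
Qed.

Lemma is_derive_chart w p : is_derive p w chart (dchart w p).
Proof.
apply: is_derive_vec3; [|exact: is_derive_cy|exact: is_derive_cz].
have H := dir_M (dir_N (is_derive_cz w p))
  (dir_D (dir_M (dir_cst p w 3) (is_derive_coord p w 1 0)) (is_derive_ck w p)).
by apply: (is_derive_eq H); ring.
Qed.

Lemma is_derive_dchart w w' p : is_derive p w' (dchart w) (ddchart w w' p).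
Proof.
have k0 := ck_gt0 p; have k1 : 1 + ck p != 0 by rewrite gt_eqF//; lra.
have c := dir_cst p w'.
have dS := is_derive_coord p w' 1 0.
have dk := is_derive_ck w' p; have dz := is_derive_cz w' p.
apply: is_derive_vec3.
- have H := dir_M (dir_N dz) (dir_D (dir_D
    (dir_M (c (S w - T w / 2)) (dir_D (dir_M (c 3) dS) dk)) (c (3 * S w)))
    (dir_M (c (T w)) dk)).
  by apply: (is_derive_eq H); ring.
- have k2 : 2 * (1 + ck p) != 0 by rewrite mulf_neq0.
  have H1 := dir_V (f := fun q => 2 * (1 + ck q)) k2 (dir_M (c 2) (dir_D (c 1) dk)).
  have H := dir_M (is_derive_cy w' p) (dir_B (c (- 2 * S w)) (dir_M (c (T w)) H1)).
  by apply: (is_derive_eq H); field.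
- have H := dir_M (c (S w - T w / 2)) dz.
  by apply: (is_derive_eq H); ring.
Qed.

Lemma partial_chart j : partial j chart = dchart (delta_mx j 0).
Proof. by apply/funext => p; case: (is_derive_chart (delta_mx j 0) p). Qed.

Lemma partial2_chart i j p :
  partial i (partial j chart) p = ddchart (delta_mx j 0) (delta_mx i 0) p.
Proof. by rewrite partial_chart; case: (is_derive_dchart (delta_mx j 0) (delta_mx i 0) p). Qed.

Lemma Ck_chart k j : Ck setT k (fun p => chart p j 0 : R^o).
Proof.
have oT : open [set: 'cV[R]_2] by exact: openT.
have CT : Ck setT k (fun p : 'cV[R]_2 => T p : R^o) by exact: Ck_coord.
have CS : Ck setT k (fun p : 'cV[R]_2 => S p : R^o) by exact: Ck_coord.
have cst c : Ck [set: 'cV[R]_2] k (fun=> c : R^o) by exact: Ck_cst.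
have Cck : Ck setT k (ck : _ -> R^o) by exact: Ck_expR.
have Ccz : Ck setT k (cz : _ -> R^o).
  by apply: Ck_expR => //; apply: CkB => //; exact: CkM.
apply: Ck_vec3 => //.
  by apply: CkM => //; [exact: CkN|apply: CkD => //; exact: CkM].
apply: CkM => //.
  by apply: Ck_expR => //; apply: CkB => //; exact: CkM.
apply: Ck_sqrt => //; last exact: CkD.
by move=> p _; have := ck_gt0 p; lra.
Qed.

Lemma immersion_chart : immersion_on setT chart.
Proof.
split; first by apply: vec_smooth_on => [|j k]; [exact: openT|exact: Ck_chart].
move=> p _; apply: (injective_diff openT (p := p)) => //.
  by move=> j; exact: Ck_chart.
move=> w Hw.
have z0 := cz_gt0 p; have y0 := cy_gt0 p; have k0 := ck_gt0 p.
have D j : dchart w p j 0 = 0.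
  apply: is_derive_unique (Hw j).
  have [d1 d2] := is_derive_chart w p; apply: DeriveDef.
    exact: (derivable_mxP chart p w).1.
  by rewrite -d2 derive_mx// mxE.
have ST : S w = T w / 2.
  have := D i2; rewrite vec3E => /eqP; rewrite mulf_eq0 (gt_eqF z0) orbF subr_eq0.
  by move/eqP.
have T0 : T w = 0.
  have := D 1; rewrite vec3E ST => /eqP; rewrite mulf_eq0 (gt_eqF y0) /= => /eqP E.
  have c0 : 0 < 1 + (2 * (1 + ck p))^-1 by rewrite addr_gt0// invr_gt0; lra.
  apply: (mulfI (lt0r_neq0 c0)); rewrite mulr0.
  have -> : (1 + (2 * (1 + ck p))^-1) * T w =
      - (- 2 * (T w / 2) - T w / (2 * (1 + ck p))).
    by field; rewrite gt_eqF//; lra.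
  by rewrite E oppr0.
by apply: cV2P; rewrite !mxE// ST T0 mul0r.
Qed.

(** For the normal c f the Gauss formula makes h proportional to 1 / c, so det h scales as c^-2,
    whereas the squared volume scales as c^2. Equating them gives 9 c^2 / 4 = 1 / (12 c^2), that is
    27 c^4 = 1; the root is positive so that h is positive definite. *)
Definition normal_scale : R := Num.sqrt (Num.sqrt (27^-1)).
Local Notation c0 := normal_scale.

Lemma normal_scale_gt0 : 0 < c0.
Proof. by rewrite !sqrtr_gt0 invr_gt0. Qed.

Lemma normal_scale4 : 27 * c0 ^+ 4 = 1.
Proof.
have -> : c0 ^+ 4 = 27^-1.
  rewrite (_ : 4%N = (2 * 2)%N)// exprM sqr_sqrtr ?sqrtr_ge0//.
  by rewrite sqr_sqrtr// invr_ge0.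
by rewrite mulfV.
Qed.

Definition affine_normal p : 'cV[R]_3 := c0 *: chart p.

Definition metric0 p : R := (2 * ck p + 3) / (12 * c0 * (1 + ck p)).
Definition metric1 p : R := (2 * ck p + 3) / (c0 * ck p).

Definition affine_metric p : 'M[R]_2 :=
  diag_mx (\row_j [:: metric0 p; metric1 p]`_j).

Lemma metric0_gt0 p : 0 < metric0 p.
Proof.
have := normal_scale_gt0; have := ck_gt0 p => k0 cp.
by rewrite divr_gt0// ?mulr_gt0//; lra.
Qed.

Lemma metric1_gt0 p : 0 < metric1 p.
Proof.
have := normal_scale_gt0; have := ck_gt0 p => k0 cp.
by rewrite divr_gt0// ?mulr_gt0//; lra.
Qed.

Lemma affine_metricE p :
  (affine_metric p 0 0 = metric0 p) * (affine_metric p 1 1 = metric1 p) *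
  (affine_metric p 0 1 = 0) * (affine_metric p 1 0 = 0).
Proof. by rewrite !mxE /= !mulr1n !mulr0n. Qed.

Lemma sum2 (V : nmodType) (F : 'I_2 -> V) : \sum_i F i = F 0 + F 1.
Proof.
by rewrite !big_ord_recl big_ord0 addr0; congr (_ + _); congr F; exact/val_inj.
Qed.

Lemma ord2_ind (P : 'I_2 -> Prop) : P 0 -> P 1 -> forall i, P i.
Proof.
move=> P0 P1 [[|[|//]] Hi].
- by rewrite (_ : Ordinal Hi = 0)//; exact/val_inj.
- by rewrite (_ : Ordinal Hi = 1)//; exact/val_inj.
Qed.

Lemma affine_metric_form p w :
  (w^T *m affine_metric p *m w) 0 0 =
  metric0 p * T w ^+ 2 + metric1 p * S w ^+ 2.
Proof.
by rewrite /affine_metric mul_mx_diag mxE sum2 !mxE /=; ring.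
Qed.

Lemma posdef_affine_metric p : posdef (affine_metric p).
Proof.
split; first by rewrite tr_diag_mx.
move=> w w0; rewrite affine_metric_form.
have := metric0_gt0 p; have := metric1_gt0 p => m1 m0.
have A0 : 0 <= metric0 p * T w ^+ 2 by rewrite mulr_ge0 ?sqr_ge0// ltW.
have A1 : 0 <= metric1 p * S w ^+ 2 by rewrite mulr_ge0 ?sqr_ge0// ltW.
rewrite lt_neqAle addr_ge0// andbT.
apply: contra w0; rewrite eq_sym paddr_eq0// => /andP[].
rewrite mulf_eq0 gt_eqF//= sqrf_eq0 => /eqP T0.
rewrite mulf_eq0 gt_eqF//= sqrf_eq0 => /eqP S0.
by apply/eqP; apply: cV2P; rewrite !mxE.
Qed.

Lemma tangent_chart p (a b : R) (v : 'cV[R]_3) :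
  v = a *: dchart (delta_mx 0 0) p + b *: dchart (delta_mx 1 0) p ->
  tangent_space chart p v.
Proof.
move=> ->; exists (vec2 a b) => //.
have J i j : Defs.jacobian chart p i j = dchart (delta_mx j 0) p i 0.
  by rewrite mxE partial_chart.
have L (u u' : 'cV[R]_3) i : (a *: u + b *: u') i 0 = a * u i 0 + b * u' i 0.
  by rewrite !mxE.
apply/colP => i; rewrite mxE sum2 !vec2E !J L.
by rewrite [a * _]mulrC [b * _]mulrC.
Qed.

Lemma blaschke_normal_chart :
  blaschke_normal setT chart affine_normal affine_metric.
Proof.
have oT : open [set: 'cV[R]_2] by exact: openT.
split.
  apply: vec_smooth_on => // j k.
  rewrite (_ : (fun q => _) = (fun q => c0 * chart q j 0)); last first.
    by apply/funext => q; rewrite mxE.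
  by apply: CkM => //; [exact: Ck_cst|exact: Ck_chart].
move=> p _; split.
- exact: posdef_affine_metric.
- have cp := normal_scale_gt0; have k0 := ck_gt0 p.
  have k1 : 1 + ck p != 0 by rewrite gt_eqF//; lra.
  have k2 : 2 * ck p + 3 != 0 by rewrite gt_eqF//; lra.
  have k3 : ck p != 0 by rewrite gt_eqF.
  have cn : c0 != 0 by rewrite gt_eqF.
  elim/ord2_ind; elim/ord2_ind; rewrite partial2_chart affine_metricE.
  (* The witnesses a and b here and below are the Christoffel symbols of the induced connection,
     found by solving for the second derivatives in the frame of the two tangent vectors and the
     normal. *)
  + apply: (tangent_chart (a := - ck p / (2 * (1 + ck p) * (2 * ck p + 3)))
      (b := ck p ^+ 2 / (6 * (1 + ck p) * (2 * ck p + 3)))).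
    apply: cV3P; rewrite /affine_normal /chart /dchart /ddchart /metric0 !(vec3E, mxE) /=;
      field; by rewrite ?k1 ?k2 ?k3 ?cn.
  + apply: (tangent_chart (a := 2 * ck p / (2 * ck p + 3))
      (b := - 3 / (2 * (2 * ck p + 3)))).
    apply: cV3P; rewrite /affine_normal /chart /dchart /ddchart !(vec3E, mxE) /=;
      field; by rewrite ?k1 ?k2 ?k3 ?cn.
  + apply: (tangent_chart (a := 2 * ck p / (2 * ck p + 3))
      (b := - 3 / (2 * (2 * ck p + 3)))).
    apply: cV3P; rewrite /affine_normal /chart /dchart /ddchart !(vec3E, mxE) /=;
      field; by rewrite ?k1 ?k2 ?k3 ?cn.
  + apply: (tangent_chart (a := 18 * (ck p + 1) / (ck p * (2 * ck p + 3)))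
      (b := 2 - 6 * (ck p + 1) / (2 * ck p + 3))).
    apply: cV3P; rewrite /affine_normal /chart /dchart /ddchart /metric1 !(vec3E, mxE) /=;
      field; by rewrite ?k1 ?k2 ?k3 ?cn.
- move=> i; have [d1 d2] := is_derive_chart (delta_mx i 0) p.
  have -> : partial i affine_normal p = c0 *: dchart (delta_mx i 0) p.
    by rewrite /partial -d2; exact: deriveZ.
  elim/ord2_ind: i {d1 d2}.
    by apply: (tangent_chart (a := c0) (b := 0)); rewrite scale0r addr0.
  by apply: (tangent_chart (a := 0) (b := c0)); rewrite scale0r add0r.
- have cp := normal_scale_gt0; have k0 := ck_gt0 p; have z0 := cz_gt0 p.
  have k1 : 1 + ck p != 0 by rewrite gt_eqF//; lra.
  have k3 : ck p != 0 by rewrite gt_eqF.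
  have cn : c0 != 0 by rewrite gt_eqF.
  rewrite det_diag big_ord_recl big_ord_recl big_ord0 !mxE/= mulr1.
  have -> : \det (row_mx (affine_normal p) (Defs.jacobian chart p)) =
      c0 * cy p * cz p ^+ 2 * (3 * ck p * (2 * ck p + 3) / (2 * (1 + ck p))).
    have r0 i : row_mx (affine_normal p) (Defs.jacobian chart p) i (0 : 'I_3) = affine_normal p i 0.
      rewrite (_ : (0 : 'I_3) = lshift 2 (0 : 'I_1)) ?row_mxEl//; exact/val_inj.
    have r1 i : row_mx (affine_normal p) (Defs.jacobian chart p) i (1 : 'I_3) =
        dchart (delta_mx 0 0) p i 0.
      rewrite (_ : (1 : 'I_3) = rshift 1 (0 : 'I_2)); last exact/val_inj.
      by rewrite row_mxEr mxE partial_chart.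
    have r2 i : row_mx (affine_normal p) (Defs.jacobian chart p) i i2 =
        dchart (delta_mx 1 0) p i 0.
      rewrite (_ : i2 = rshift 1 (1 : 'I_2)); last exact/val_inj.
      by rewrite row_mxEr mxE partial_chart.
    rewrite det3 !r0 !r1 !r2 /affine_normal /chart /dchart !(vec3E, mxE) /=.
    by field.
  (* The equation of the level set eliminates y and z from the squared determinant, leaving kappa
     and the scale. *)
  have E : cy p ^+ 2 * cz p ^+ 4 * ck p ^+ 3 = 1 + ck p.
    rewrite /cy exprMn sqr_sqrtr; last by rewrite addr_ge0// ltW.
    rewrite /cz {2}/ck -!expRM_natl mulrAC -mulrA -mulrA -expRD mulrCA -expRD.
    rewrite [X in expR X](_ : _ = 0) ?expR0 ?mulr1//.
    by field.
  have -> : metric0 p * metric1 p = (2 * ck p + 3) ^+ 2 / (12 * c0 ^+ 2 * ck p * (1 + ck p)).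
    by rewrite /metric0 /metric1; field; rewrite k1 k3 cn.
  have -> : (c0 * cy p * cz p ^+ 2 * (3 * ck p * (2 * ck p + 3) / (2 * (1 + ck p)))) ^+ 2 =
      c0 ^+ 2 * (cy p ^+ 2 * cz p ^+ 4 * ck p ^+ 3) *
      (9 * (2 * ck p + 3) ^+ 2 / (4 * ck p * (1 + ck p) ^+ 2)).
    by field; rewrite k1 k3.
  rewrite E.
  have c4 : c0 ^+ 2 = (27 * c0 ^+ 2)^-1.
    apply: (mulfI (x := 27 * c0 ^+ 2)); first by rewrite mulf_neq0// expf_neq0.
    rewrite mulfV ?mulf_neq0 ?expf_neq0//; apply: etrans normal_scale4; ring.
  rewrite [in LHS]c4; field; by rewrite k1 k3 cn.
Qed.

Lemma affine_normal_proportional p : exists t : R, chart p + t *: affine_normal p = 0.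
Proof.
exists (- c0^-1); rewrite scalerA mulNr mulVf ?gt_eqF ?normal_scale_gt0//.
by rewrite scaleN1r subrr.
Qed.

End blaschke_chart.

(** * Completeness of the affine metric *)

Section completeness.
Context {R : realType}.
Implicit Types p q w : 'cV[R]_2.

Local Notation T p := (p 0 0).
Local Notation S p := (p 1 0).
Local Notation c0 := (@normal_scale R).
Local Notation mu := (@lebesgue_measure R).

Definition speed (c : R -> 'cV[R]_2) (t : R) : R :=
  Num.sqrt (((derive1 c t)^T *m affine_metric (c t) *m derive1 c t) 0 0).

Lemma path_lengthE c : path_length (@affine_metric R) c =
  (\int[mu]_(t in `[0%R, 1%R]) (speed c t)%:E)%E.
Proof. by []. Qed.

Lemma path_continuous U p q c : C1_path U p q c -> continuous c.
Proof.
by case=> d _ _ _ _ t; apply: differentiable_continuous; exact/derivable1_diffP.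
Qed.

Lemma coord_path_continuous (c : R -> 'cV[R]_2) i : continuous c ->
  continuous (fun t => c t i 0 : R).
Proof.
move=> cc t; apply: (@continuous_comp _ _ _ c (fun v : 'cV[R]_2 => v i 0 : R)).
  exact: cc.
exact: coord_continuous.
Qed.

Lemma speed_continuous U p q c : C1_path U p q c -> continuous (speed c).
Proof.
move=> Hc; have cc := path_continuous Hc; have [_ cd _ _ _] := Hc.
have T' := coord_path_continuous (i := 0) cd; have S' := coord_path_continuous (i := 1) cd.
have TT := coord_path_continuous (i := 0) cc.
have ckc : continuous (fun t => ck (c t) : R).
  move=> t; apply: (@continuous_comp _ _ _ (fun t => T (c t)) (@expR R)).
    exact: TT.
  exact: continuous_expR.
have cp := @normal_scale_gt0 R.
have cst (a : R) : continuous (fun _ : R => a) by move=> ?; exact: cst_continuous.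
have contD (f g : R -> R) : continuous f -> continuous g ->
    continuous (fun t => f t + g t).
  by move=> cf cg t; exact: (@continuousD _ R^o _ f g t (cf t) (cg t)).
have contM (f g : R -> R) : continuous f -> continuous g ->
    continuous (fun t => f t * g t).
  by move=> cf cg t; exact: (@continuousM _ _ f g t (cf t) (cg t)).
have contV (f : R -> R) : (forall t, f t != 0) -> continuous f ->
    continuous (fun t => (f t)^-1).
  by move=> f0 cf t; exact: (@continuousV _ _ f t (f0 t) (cf t)).
have num : continuous (fun t => 2 * ck (c t) + 3 : R) by apply/contD/cst/contM.
have m0 : continuous (fun t => metric0 (c t) : R).
  apply: (contM) => //; apply: (contV).
    move=> t; have k0 := ck_gt0 (c t); rewrite gt_eqF// mulr_gt0//; last lra.
    by rewrite mulr_gt0.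
  by apply: (contM) => //; exact: contD.
have m1 : continuous (fun t => metric1 (c t) : R).
  apply: (contM) => //; apply: (contV); last exact: contM.
  by move=> t; rewrite gt_eqF// mulr_gt0// ck_gt0.
rewrite /speed; under eq_fun do rewrite affine_metric_form.
have sq (f : R -> R) : continuous f -> continuous (fun t => f t ^+ 2).
  by move=> cf; exact: contM.
move=> t; apply: (@continuous_comp _ _ _ (fun t => metric0 (c t) * T (derive1 c t) ^+ 2 +
  metric1 (c t) * S (derive1 c t) ^+ 2)); last exact: sqrt_continuous.
by apply: (contD); apply: (contM) => //; exact: sq.
Qed.

Lemma speed_ge0 c t : 0 <= speed c t. Proof. exact: sqrtr_ge0. Qed.

(** 1 / (6 c0) is the limit of [metric0] as kappa tends to infinity and bounds both diagonal
    coefficients from below. *)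
Definition low_scale : R := Num.sqrt (6 * c0)^-1.

Lemma low_scale_gt0 : 0 < low_scale.
Proof. by rewrite sqrtr_gt0 invr_gt0 mulr_gt0// normal_scale_gt0. Qed.

Lemma speed_ge (c : R -> 'cV[R]_2) t i : low_scale * `|derive1 c t i 0| <= speed c t.
Proof.
have cp := @normal_scale_gt0 R; have k0 := ck_gt0 (c t).
rewrite /low_scale -sqrtr_sqr -sqrtrM ?invr_ge0 ?mulr_ge0 ?(ltW cp)//.
rewrite /speed affine_metric_form; apply: ler_wsqrtr.
have M0 : (6 * c0)^-1 <= metric0 (c t).
  rewrite /metric0 ler_pdivlMr ?mulr_gt0//; last lra.
  rewrite (_ : _^-1 * _ = 2 * (1 + ck (c t))); first lra.
  by field; rewrite gt_eqF.
have M1 : (6 * c0)^-1 <= metric1 (c t).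
  rewrite /metric1 ler_pdivlMr ?mulr_gt0//.
  rewrite (_ : _^-1 * _ = ck (c t) / 6); first lra.
  by field; rewrite gt_eqF.
have s0 := sqr_ge0 (T (derive1 c t)); have s1 := sqr_ge0 (S (derive1 c t)).
have n0 := le_trans _ M0; have n1 := le_trans _ M1.
have c6 : 0 <= (6 * c0)^-1 by rewrite invr_ge0 mulr_ge0// ltW.
elim/ord2_ind: i.
  by rewrite -[leLHS]addr0 lerD ?ler_wpM2r// mulr_ge0// (le_trans c6).
by rewrite -[leLHS]add0r lerD ?ler_wpM2r// mulr_ge0// (le_trans c6).
Qed.

(** The speed dominates [low_scale] times the absolute derivative of each coordinate, whose integral
    is at least the coordinate increment. *)
Lemma path_length_ge U p q c i : C1_path U p q c ->
  ((low_scale * `|q i 0 - p i 0|)%:E <= path_length (@affine_metric R) c)%E.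
Proof.
move=> Hc; have [dc cd _ E0 E1] := Hc.
have ci := coord_path_continuous (i := i) cd.
pose f t : R := derive1 c t i 0.
have fcont : {within `[0%R, 1%R], continuous f} by exact: continuous_subspaceT.
have dci (t : R) : is_derive t 1 (fun t => c t i 0) (f t).
  apply: DeriveDef; first exact: (derivable_mxP c t 1).1.
  by rewrite /f derive1E derive_mx// mxE.
have F : (\int[mu]_(t in `[0%R, 1%R]) (f t)%:E = (q i 0)%:E - (p i 0)%:E)%E.
  rewrite -E0 -E1; apply: (@continuous_FTC2 R f (fun t => c t i 0)) => //.
    split.
    - by move=> t _; case: (dci t).
    - apply: cvg_at_right_filter; exact: is_derive_real_continuous (dci 0).
    - apply: cvg_at_left_filter; exact: is_derive_real_continuous (dci 1).
  by move=> t _; rewrite derive1E; case: (dci t).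
have mf : measurable_fun (`[(0 : R), 1]%classic : set R) (fun t => (f t)%:E).
  by apply/measurable_EFinP; apply: subspace_continuous_measurable_fun.
have ms : measurable_fun (`[(0 : R), 1]%classic : set R) (fun t => (speed c t)%:E).
  apply/measurable_EFinP; apply: subspace_continuous_measurable_fun => //.
  by apply: continuous_subspaceT; exact: speed_continuous Hc.
have l0 := low_scale_gt0.
rewrite EFinM -(@abse_EFin _ (q i 0 - p i 0)) EFinB -F.
apply: (@le_trans _ _ (low_scale%:E * \int[mu]_(t in `[0%R, 1%R]) `|(f t)%:E|)%E).
  apply: lee_wpmul2l; first by rewrite lee_fin ltW.
  exact: le_abse_integral.
rewrite -ge0_integralZl//; last by rewrite lee_fin ltW.
  rewrite path_lengthE; apply: ge0_le_integral => //.
  - by move=> t _; rewrite mule_ge0// lee_fin ltW.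
  - apply: measurable_funeM; exact: measurableT_comp.
  - by move=> t _; rewrite /= -EFinM lee_fin; exact: speed_ge.
exact: measurableT_comp.
Qed.

Lemma metric_dist_ge U p q i :
  ((low_scale * `|q i 0 - p i 0|)%:E <= metric_dist U (@affine_metric R) p q)%E.
Proof. by apply: le_ereal_inf_tmp => _ [c Hc <-]; exact: path_length_ge Hc. Qed.

Lemma metric_dist_ge_norm U p q :
  ((low_scale * `|q - p|)%:E <= metric_dist U (@affine_metric R) p q)%E.
Proof.
have l0 := low_scale_gt0.
have [D|D] := eqVneq (q - p) 0.
  rewrite D normr0 mulr0; apply: le_trans (metric_dist_ge U p q 0).
  by rewrite lee_fin mulr_ge0// ltW.
have : `|q - p| <= Num.max `|T (q - p)| `|S (q - p)|.
  apply: norm_mx_le => [|i j]; first by rewrite le_max normr_ge0.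
  rewrite (ord1 j) le_max; elim/ord2_ind: i; rewrite lexx ?orbT//.
rewrite le_max => /orP[] H.
  apply: le_trans (metric_dist_ge U p q 0).
  by rewrite lee_fin ler_pM2l//; move: H; rewrite !mxE.
apply: le_trans (metric_dist_ge U p q 1).
by rewrite lee_fin ler_pM2l//; move: H; rewrite !mxE.
Qed.

(** On the half-plane T >= t, [metric0] is at most 1 / (4 c0) and [metric1] = (2 + 3 / kappa) / c0
    at most (2 + 3 / exp(t)) / c0. No global bound exists, since [metric1] blows up as kappa tends
    to 0. *)
Definition high_scale (t : R) : R :=
  Num.sqrt ((4 * c0)^-1 + (2 + 3 / expR t) / c0).

(** The straight segment from p to q stays in the half-plane T >= t, and its length bounds the
    distance. *)
Lemma metric_dist_le p q (t : R) : t <= T p -> t <= T q ->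
  (metric_dist setT (@affine_metric R) p q <= (high_scale t * `|q - p|)%:E)%E.
Proof.
move=> tp tq.
pose c (s : R) : 'cV[R]_2 := s *: (q - p) + p.
have dc (s : R) : is_derive s 1 c (q - p).
  have H : is_derive s (1 : R) (fun s : R => s *: (q - p)) (1 *: (q - p)).
    by apply: DeriveDef; [exact/derivable1_diffP|rewrite deriveE// diff_val].
  have := @is_deriveD _ _ _ _ (cst p) s 1 _ _ H (is_derive_cst _ _ _).
  by rewrite scale1r addr0.
have d1 : derive1 c = (fun=> q - p).
  by apply/funext => s; rewrite derive1E; case: (dc s).
have Hc : C1_path setT p q c.
  split=> //.
  - by rewrite d1 => s; exact: cst_continuous.
  - by rewrite /c scale0r add0r.
  - by rewrite /c scale1r subrK.
apply: (@le_trans _ _ (path_length (@affine_metric R) c)).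
  by apply: ereal_inf_lbound; exists c.
have cp := @normal_scale_gt0 R.
rewrite path_lengthE.
have -> : ((high_scale t * `|q - p|)%:E =
    \int[mu]_(s in `[0%R, 1%R]) (cst (high_scale t * `|q - p|)%:E s))%E.
  rewrite integral_cst//= lebesgue_measure_itv/= lte_fin ltr01.
  by rewrite -EFinB subr0 mule1.
apply: ge0_le_integral => //.
- by move=> s _; rewrite lee_fin speed_ge0.
- apply/measurable_EFinP; apply: subspace_continuous_measurable_fun => //.
  by apply: continuous_subspaceT; exact: speed_continuous Hc.
- move=> s; rewrite /= in_itv/= => /andP[s0 s1]; rewrite lee_fin.
  have tc : t <= T (c s).
    rewrite /c !mxE.
    have : 0 <= s * (T q - t) + (1 - s) * (T p - t).
      by rewrite addr_ge0// mulr_ge0//; lra.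
    lra.
  have k0 := ck_gt0 (c s).
  have et : expR t <= ck (c s) by rewrite ler_expR.
  have e0 := expR_gt0 t.
  have q0 : 0 <= (4 * c0)^-1 + (2 + 3 / expR t) / c0.
    by rewrite addr_ge0 ?invr_ge0 ?mulr_ge0 ?invr_ge0 ?addr_ge0 ?divr_ge0// ltW.
  rewrite /speed /high_scale d1 affine_metric_form.
  rewrite -[`|q - p|]ger0_norm// -sqrtr_sqr -sqrtrM//; apply: ler_wsqrtr.
  have sq i : (q - p) i 0 ^+ 2 <= `|q - p| ^+ 2.
    rewrite -[leLHS]real_normK ?num_real// ler_sqr ?nnegrE//; exact: mx_norm_coord.
  rewrite mulrDl; apply: lerD; apply: ler_pM; rewrite ?sqr_ge0//.
  + exact/ltW/metric0_gt0.
  + rewrite /metric0 ler_pdivrMr ?mulr_gt0//; last lra.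
    rewrite (_ : _^-1 * _ = 3 * (1 + ck (c s))); first lra.
    by field; rewrite gt_eqF.
  + exact/ltW/metric1_gt0.
  + rewrite /metric1 [leLHS](_ : _ = (2 + 3 / ck (c s)) / c0); last first.
      by field; rewrite !gt_eqF.
    rewrite ler_pM2r ?invr_gt0// lerD2l ler_pM2l// lef_pV2 ?posrE//.
Qed.

Lemma complete_affine_metric : complete_metric setT (@affine_metric R).
Proof.
move=> u _ cu.
have l0 := low_scale_gt0.
have cauchy_u : cauchy (u @ \oo).
  apply/cauchyP => e e0.
  have [N HN] := cu (low_scale * e) (mulr_gt0 l0 e0).
  exists (u N); exists N => // k /= Nk.
  rewrite -ball_normE/= -(ltr_pM2l l0) -lte_fin distrC.
  exact: le_lt_trans (metric_dist_ge_norm _ _ _) (HN _ _ (leqnn N) Nk).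
have /cvg_ex[p up] : cvg (u @ \oo) by exact: cauchy_cvg.
(* Terms within 1 of the Euclidean limit p have T above T p - 1, so one constant of [metric_dist_le]
   serves for all of them. *)
exists p => //.
apply: (@squeeze_cvge _ _ _ _ (cst 0%E) _
    (fun k => (high_scale (T p - 1) * `|p - u k|)%:E)).
- near=> k; apply/andP; split.
    apply: le_trans (metric_dist_ge_norm setT (u k) p).
    by rewrite lee_fin mulr_ge0// ltW.
  apply: metric_dist_le; last by rewrite gerBl.
  have : `|p - u k| < 1 by near: k; move/cvgrPdist_lt : up; exact.
  move=> /(le_lt_trans (mx_norm_coord _ 0 0)); rewrite !mxE ltr_norml => /andP[_].
  lra.
- exact: cvg_cst.
- apply: cvg_EFin; first exact: nearW.
  rewrite -[X in _ --> X](mulr0 (high_scale (T p - 1))).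
  apply: cvgMl_tmp.
  have /cvg_norm : (p - u k) @[k --> \oo] --> p - p.
    by apply: cvgB => //; exact: cvg_cst.
  by rewrite subrr normr0.
Unshelve. all: by end_near. Qed.

End completeness.

(** * The convex hull of the sphere *)

Section convexity.
Context {R : realType}.
Implicit Types v a b : 'cV[R]_3.

Local Notation X v := (v 0 0).
Local Notation Y v := (v 1 0).
Local Notation Z v := (v i2 0).

Definition sublevel : set 'cV[R]_3 := [set v | exp_cone_int v /\ potential v <= 0].

Lemma exp_cone_int_convex a b (t : R) : 0 <= t -> t <= 1 ->
  exp_cone_int a -> exp_cone_int b -> exp_cone_int (t *: a + (1 - t) *: b).
Proof.
move=> t0 t1 Da Db.
have [->|tn0] := eqVneq t 0; first by rewrite scale0r add0r subr0 scale1r.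
have tp : 0 < t by rewrite lt_neqAle eq_sym tn0.
rewrite addrC -interior_exp_cone; apply: cone_interiorD => //.
- exact: regular_exp_cone.
- have [cv _ _ _] := @regular_exp_cone R.
  have s0 : 0 <= 1 - t by lra.
  have Kb := exp_cone_int_sub Db.
  by have := cv _ _ _ _ s0 (lexx 0) Kb Kb; rewrite scale0r addr0.
- by rewrite interior_exp_cone.
Qed.

(** A positive value inside the segment would give a positive slope before it and a negative slope
    after it; the mean value theorem for the slope then contradicts the nonnegative second
    derivative. *)
Lemma potential_convex_le0 a b (t : R) : 0 <= t -> t <= 1 ->
  sublevel a -> sublevel b -> sublevel (t *: a + (1 - t) *: b).
Proof.
move=> t0 t1 [Da pa] [Db pb]; split; first exact: exp_cone_int_convex.
pose g (s : R) := potential (s *: (a - b) + b).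
pose dg := line_derivative (potential : _ -> R^o) b (a - b).
have E s : s *: (a - b) + b = s *: a + (1 - s) *: b.
  by rewrite scalerBr scalerBl scale1r [b - _]addrC addrA.
have Ds s : 0 <= s -> s <= 1 -> exp_cone_int (s *: (a - b) + b).
  by move=> s0 s1; rewrite E; exact: exp_cone_int_convex.
have oD := @open_exp_cone_int R.
have C2 : Ck exp_cone_int 2 (potential : 'cV[R]_3 -> R^o).
  exact: ((smooth_onP _ _).1 (@potential_smooth R) 2).
have gd (s : R) : 0 <= s -> s <= 1 -> is_derive s 1 g (dg s).
  by move=> s0 s1; apply: (is_derive_line oD (CkW C2)); exact: Ds.
have dgd (s : R) : 0 <= s -> s <= 1 ->
    is_derive s 1 dg (qform (hessian potential (s *: (a - b) + b)) (a - b)).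
  by move=> s0 s1; apply: (is_derive_line2 oD C2); exact: Ds.
have q0 (s : R) : 0 <= s -> s <= 1 ->
    0 <= qform (hessian potential (s *: (a - b) + b)) (a - b).
  move=> s0 s1; have [_ H] := posdef_hessian_potential (Ds s s0 s1).
  have [->|n0] := eqVneq (a - b) 0; last exact/ltW/H.
  by rewrite /qform mulmx0 mxE.
have g0 : g 0 <= 0 by rewrite /g scale0r add0r.
have g1 : g 1 <= 0 by rewrite /g scale1r subrK.
rewrite -E -/(g t) leNgt; apply/negP => gt0.
have tp : 0 < t.
  by rewrite lt_neqAle t0 andbT; apply/eqP => t00; move: gt0; rewrite -t00 ltNge g0.
have tl : t < 1.
  by rewrite lt_neqAle t1 andbT; apply/eqP => t11; move: gt0; rewrite t11 ltNge g1.
have MV (f df : R -> R) (x y : R) : 0 <= x -> x < y -> y <= 1 ->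
    (forall s : R, 0 <= s -> s <= 1 -> is_derive s 1 f (df s)) ->
    exists2 c, x < c < y & f y - f x = df c * (y - x).
  move=> x0 xy y1 Hf.
  have H1 (s : R) : s \in `]x, y[%R -> is_derive s 1 f (df s).
    by rewrite in_itv/= => /andP[? ?]; apply: Hf; lra.
  have H2 : {within `[x, y], continuous f}.
    apply: derivable_within_continuous => s; rewrite in_itv/= => /andP[? ?].
    have s0 : 0 <= s by lra.
    have s1 : s <= 1 by lra.
    by have [] := Hf s s0 s1.
  by have [c] := MVT xy H1 H2; rewrite in_itv/=; exists c.
have [c /andP[c0 ct] Ec] := MV g dg 0 t (lexx _) tp t1 gd.
have [d /andP[td d1] Ed] := MV g dg t 1 t0 tl (lexx _) gd.
have cd : c < d := lt_trans ct td.
have [f /andP[cf fd] Ef] := MV dg _ c d (ltW c0) cd (ltW d1) dgd.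
have dc : 0 < dg c.
  have : 0 < dg c * (t - 0) by rewrite -Ec subr_gt0 (le_lt_trans g0).
  by rewrite subr0 pmulr_lgt0.
have dd : dg d < 0.
  have : dg d * (1 - t) < 0 by rewrite -Ed subr_lt0 (le_lt_trans g1).
  by rewrite pmulr_llt0// subr_gt0.
have : 0 <= dg d - dg c.
  rewrite Ef mulr_ge0 ?subr_ge0 ?(ltW cd)//; apply: q0; apply: ltW.
    exact: lt_trans cf.
  exact: lt_trans fd d1.
by rewrite subr_ge0 leNgt (lt_trans dd dc).
Qed.

Lemma convex_sublevel : convex_set sublevel.
Proof.
move=> x y l; rewrite !inE => Lx Ly.
exact: (@potential_convex_le0 x y l%:num (ge0 l) (le1 l) Lx Ly).
Qed.

Lemma conv_hull_zero_level : conv_hull (@zero_level R) `<=` sublevel.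
Proof.
apply: smallest_sub; first exact: convex_sublevel.
by move=> v [Dv pv]; split=> //; rewrite pv.
Qed.

Lemma potential_cvg v : exp_cone_int v -> {for v, continuous (potential : _ -> R^o)}.
Proof.
by move=> Dv; exact: (Ck_continuous ((smooth_onP _ _).1 (@potential_smooth R) 0) Dv).
Qed.

(** Shrinking v slightly towards the vertex adds - 3 ln (1 - s) > 0 to the potential, so arbitrarily
    near v there are points outside the sublevel set and hence outside the hull. *)
Lemma zero_level_interior : zero_level `&` (conv_hull (@zero_level R))° = set0.
Proof.
rewrite -subset0 => v [[Dv pv] Iv].
have sc : continuous (fun t : R => t *: v).
  by move=> t; apply: cvgZr_tmp; exact: cvg_id.
have : \forall t \near (1 : R), conv_hull (@zero_level R) (t *: v).
  by apply: sc; rewrite scale1r.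
case/nbhs_normP => r /= r0 Hr.
pose s := Num.min (r / 2) (1 / 2).
have s0 : 0 < s by rewrite lt_min !divr_gt0.
have sr : s < r by rewrite gt_min; apply/orP; left; lra.
have s1 : s < 1 by rewrite gt_min; apply/orP; right; lra.
have t0 : 0 < 1 - s by lra.
have /conv_hull_zero_level[_] : conv_hull (@zero_level R) ((1 - s) *: v).
  by apply: Hr; rewrite /ball_/= opprB addrC subrK gtr0_norm.
rewrite potentialZ// pv sub0r oppr_le0 pmulr_rge0// leNgt ln_lt0//.
by rewrite t0; lra.
Qed.

(** Limits on the boundary of the cone are excluded because the potential tends to +oo there. *)
Lemma closed_sublevel : closed sublevel.
Proof.
move=> p Lp.
have Kp : exp_cone p.
  case: (@regular_exp_cone R) => _ cK _ _; apply: cK => B /Lp[v [[Dv _] Bv]].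
  by exists v; split=> //; exact: exp_cone_int_sub.
have Dp : exp_cone_int p.
  apply: contrapT => nDp.
  have clp : closure (@exp_cone R) p by exact: subset_closure.
  have nI : ~ (@exp_cone R)° p by rewrite interior_exp_cone.
  have /cvgryPge/(_ 1) := potential_boundary clp nI.
  rewrite near_withinE interior_exp_cone => /Lp[v [[Dv pv] /(_ Dv)]].
  by move=> /le_trans/(_ pv); rewrite ler10.
split=> //; rewrite leNgt; apply/negP => pp.
have C := potential_cvg Dp.
have /Lp : \forall v \near (p : 'cV[R]_3), 0 < potential v by exact: (cvgr_gt _ C).
by case=> v [[_ H]]; rewrite ltNge H.
Qed.

Lemma open_strict_sublevel :
  open [set v : 'cV[R]_3 | exp_cone_int v /\ potential v < 0].
Proof.
rewrite openE => p [Dp pp]; have C := potential_cvg Dp.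
have H : \forall v \near (p : 'cV[R]_3), exp_cone_int v /\ potential v < 0.
  apply: filterI; last exact: (cvgr_lt _ C).
  exact: open_nbhs_nbhs (conj (@open_exp_cone_int R) Dp).
by move: H; apply: (@filterS _ (nbhs p)).
Qed.

(** If a connected C met the hull but missed the sphere, its part with F <= 0 would be its part with
    F < 0, hence both closed and open in C. Then C would lie in the sublevel set, which does not
    contain 0. *)
Lemma separates_zero_level :
  separates (@zero_level R) (conv_hull (@zero_level R)) 0.
Proof.
have nD : ~ exp_cone_int (0 : 'cV[R]_3) by case; rewrite mxE ltxx.
split; first by case.
move=> C cC C0 [v [Cv Hv]].
apply: contrapT => nS.
have Lv := conv_hull_zero_level Hv.
have /cC E : C `&` sublevel !=set0 by exists v.
have : C `&` sublevel = C.
  apply: E.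
    exists [set v : 'cV[R]_3 | exp_cone_int v /\ potential v < 0].
      exact: open_strict_sublevel.
    apply/seteqP; split=> w [Cw [Dw pw]]; split=> //; split=> //; last exact: ltW.
    rewrite lt_neqAle pw andbT; apply/eqP => p0; apply: nS.
    by exists w.
  by exists sublevel => //; exact: closed_sublevel.
move=> /seteqP[_ /(_ 0 C0)[_ [D0 _]]].
exact: nD.
Qed.

End convexity.

(** * Asymptotics at infinity *)

Section asymptotics.
Context {R : realType}.

Local Notation X v := (v 0 0).
Local Notation Y v := (v 1 0).
Local Notation Z v := (v i2 0).

(** A crude substitute for n-th roots, sufficient where only boundedness matters. *)
Lemma le_1D_of_exp_le (x c : R) n : (0 < n)%N -> 0 <= x -> x ^+ n <= c -> x <= 1 + c.
Proof.
move=> n0 x0 xc; have c0 : 0 <= c by apply: le_trans xc; exact: exprn_ge0.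
have [x1|x1] := leP x 1; first by lra.
have : x <= x ^+ n by rewrite ler_eXnr// ltW.
lra.
Qed.

(* The equation is that of the sphere and the bounds by e say that the point
   (kappa, z) keeps distance e from the boundary of the cone. *)
Lemma far_points_bounded (e : R) : 0 < e -> exists a b : R, [/\ 0 < a, 0 < b &
  forall k z y : R, 0 < k -> 0 < z -> 0 < y ->
    y ^+ 2 * z ^+ 4 * k ^+ 3 = 1 + k -> e <= y -> e <= z * theta k ->
    e <= y * theta k -> (- z * (3 * ln z + 3 / 2 * ln k + k) <= 0 -> e <= z) ->
    [/\ a <= k, k <= b, a <= z & z <= b]].
Proof.
(* Since theta(k) <= 3 k / 2, the bounds e <= z theta(k) and e <= y theta(k) become d <= z k and d
   <= y k. *)
move=> e0; pose d := 2 * e / 3.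
have d0 : 0 < d by rewrite /d; lra.
(* z1 bounds z when k <= 1; z2 and k1 bound z and k when k > 1, the two fractions in k1 serving x <=
   0 and x > 0. The lower bounds in a then follow from d <= z k. *)
pose z1 := 1 + 2 / d ^+ 3; pose z2 := 1 + 2 / e ^+ 2.
pose k1 := 1 + 2 / e ^+ 6 + 16 / d ^+ 6.
have z10 : 1 <= z1 by rewrite /z1 lerDl divr_ge0// exprn_ge0// ltW.
have z20 : 1 <= z2 by rewrite /z2 lerDl divr_ge0// exprn_ge0// ltW.
have e60 : 0 <= 2 / e ^+ 6 by rewrite divr_ge0// exprn_ge0// ltW.
have d60 : 0 <= 16 / d ^+ 6 by rewrite divr_ge0// exprn_ge0// ltW.
have k10 : 1 <= k1 by rewrite /k1; lra.
pose a := Num.min (Num.min (d / z1) d) (Num.min 1 (d / k1)).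
pose b := z1 + z2 + k1.
have z1p : 0 < z1 by lra.
have k1p : 0 < k1 by lra.
have a1 : 0 < d / z1 by apply: divr_gt0.
have a2 : 0 < d / k1 by apply: divr_gt0.
have z2p : 0 < z2 := lt_le_trans ltr01 z20.
exists a, b; split.
- by rewrite /a !lt_min a1 d0 ltr01 a2.
- by rewrite /b; apply: addr_gt0 => //; exact: addr_gt0.
move=> k z y k0 z0 y0 E ey ez eyt ex.
have th : theta k <= 3 / 2 * k.
  have k1' : -1 < k by lra.
  have := le_ln1Dx k1'; rewrite /theta; lra.
have zk : d <= z * k.
  have : z * theta k <= z * (3 / 2 * k) by rewrite ler_pM2l.
  rewrite /d; lra.
have yk : d <= y * k.
  have : y * theta k <= y * (3 / 2 * k) by rewrite ler_pM2l.
  rewrite /d; lra.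
have [kl1|kg1] := leP k 1.
  have z3 : z ^+ 3 <= 2 / d ^+ 3.
    rewrite ler_pdivlMr ?exprn_gt0//.
    have -> : z ^+ 3 * d ^+ 3 = d ^+ 2 * d * z ^+ 3 by ring.
    apply: (@le_trans _ _ ((y * k) ^+ 2 * (z * k) * z ^+ 3)).
      rewrite ler_pM2r ?exprn_gt0//; apply: ler_pM => //; rewrite ?sqr_ge0 ?(ltW d0)//.
      by rewrite ler_sqr ?nnegrE// ?(ltW d0)// mulr_ge0// ltW.
    have -> : (y * k) ^+ 2 * (z * k) * z ^+ 3 = y ^+ 2 * z ^+ 4 * k ^+ 3 by ring.
    by rewrite E; lra.
  have zz1 : z <= z1 by apply: le_1D_of_exp_le z3 => //; exact: ltW.
  have dz : d <= z.
    by apply: (le_trans zk); rewrite -[leRHS]mulr1 ler_pM2l.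
  split.
  - rewrite /a !ge_min; apply/orP; left; apply/orP; left.
    rewrite ler_pdivrMr// mulrC; apply: (le_trans zk).
    by rewrite ler_pM2r.
  - rewrite /b; lra.
  - by rewrite /a !ge_min dz orbT.
  - rewrite /b; lra.
have z4k2 : e ^+ 2 * z ^+ 4 * k ^+ 2 <= 2.
  rewrite -(ler_pM2r k0).
  have -> : e ^+ 2 * z ^+ 4 * k ^+ 2 * k = e ^+ 2 * (z ^+ 4 * k ^+ 3) by ring.
  apply: (@le_trans _ _ (y ^+ 2 * (z ^+ 4 * k ^+ 3))).
    rewrite ler_pM2r ?mulr_gt0 ?exprn_gt0//.
    by rewrite ler_sqr ?nnegrE// ltW.
  by rewrite mulrA E; lra.
have kk : 1 <= k ^+ 2 by rewrite exprn_ege1// ltW.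
have zz2 : z <= z2.
  apply: (@le_1D_of_exp_le _ _ 4) => //; first exact: ltW.
  rewrite ler_pdivlMr ?exprn_gt0// mulrC; apply: le_trans z4k2.
  by rewrite ler_peMr// mulr_ge0// exprn_ge0// ltW.
have kk1 : k <= k1.
  have [x0|x0] := leP (- z * (3 * ln z + 3 / 2 * ln k + k)) 0.
    have {}ex := ex x0.
    have : k ^+ 2 <= 2 / e ^+ 6.
      rewrite ler_pdivlMr ?exprn_gt0//; apply: le_trans z4k2.
      have -> : k ^+ 2 * e ^+ 6 = e ^+ 2 * e ^+ 4 * k ^+ 2 by ring.
      rewrite ler_pM2r ?exprn_gt0// ler_pM2l ?exprn_gt0//.
      by rewrite lerXn2r ?nnegrE// ltW.
    move=> /(@le_1D_of_exp_le _ _ 2 isT (ltW k0)); rewrite /k1; lra.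
  (* For x > 0, exponentiating gives z^6 k^3 exp(2 k) < 1. Multiplying by k^3 and using z k >= d and
     exp(2 k) >= (k / 2)^4 leaves d^6 (k / 2)^4 < k^3, which bounds k. *)
  have H : ln z *+ 6 + ln k *+ 3 + 2 * k < 0.
    move: x0; rewrite mulNr oppr_gt0 pmulr_rlt0//; lra.
  have H2 : z ^+ 6 * k ^+ 3 * expR (2 * k) < 1.
    have -> : z ^+ 6 * k ^+ 3 * expR (2 * k) = expR (ln z *+ 6 + ln k *+ 3 + 2 * k).
      by rewrite -!lnXn// !expRD !lnK ?posrE ?exprn_gt0.
    by rewrite expR_lt1.
  have H3 : (k / 2) ^+ 4 <= expR (2 * k).
    have -> : 2 * k = 4%:R * (k / 2) by field.
    rewrite expRM_natl lerXn2r ?nnegrE ?expR_ge0 ?divr_ge0// ?(ltW k0)//.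
    by have := expR_ge1Dx (k / 2); lra.
  have H4 : d ^+ 6 * (k / 2) ^+ 4 < k ^+ 3.
    apply: (@le_lt_trans _ _ ((z * k) ^+ 6 * expR (2 * k))).
      apply: ler_pM; rewrite ?exprn_ge0 ?(ltW d0)// ?divr_ge0// ?(ltW k0)//.
      by rewrite lerXn2r ?nnegrE ?(ltW d0)// mulr_ge0// ltW.
    have -> : (z * k) ^+ 6 * expR (2 * k) = z ^+ 6 * k ^+ 3 * expR (2 * k) * k ^+ 3 by ring.
    by rewrite -[ltRHS]mul1r ltr_pM2r ?exprn_gt0.
  have : k < 16 / d ^+ 6.
    rewrite ltr_pdivlMr ?exprn_gt0// -(ltr_pM2r (x := k ^+ 3 / 16)) ?divr_gt0 ?exprn_gt0//.
    have -> : k * d ^+ 6 * (k ^+ 3 / 16) = d ^+ 6 * (k / 2) ^+ 4 by field.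
    by rewrite [ltRHS]mulrC divfK.
  by rewrite /k1; lra.
split.
- by rewrite /a !ge_min (ltW kg1) ?orbT.
- rewrite /b; lra.
- rewrite /a !ge_min; apply/orP; right; apply/orP; right.
  by rewrite ler_pdivrMr//; apply: (le_trans zk); rewrite ler_pM2l.
- rewrite /b; lra.
Qed.

Lemma norm_vec3_sub (v : 'cV[R]_3) (x y z c : R) : 0 <= c ->
  `|X v - x| <= c -> `|Y v - y| <= c -> `|Z v - z| <= c -> `|v - vec3 x y z| <= c.
Proof.
move=> c0 Hx Hy Hz; apply: norm_mx_le => // i j; rewrite (ord1 j).
have -> : (v - vec3 x y z) i 0 = v i 0 - vec3 x y z i 0 by rewrite !mxE.
by elim/ord3_ind: i; rewrite vec3E.
Qed.

Lemma boundary_point (q : 'cV[R]_3) : exp_cone q -> ~ exp_cone_int q ->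
  closure (@exp_cone R) q /\ ~ (@exp_cone R)° q.
Proof. by move=> Kq nq; split; [exact: subset_closure|rewrite interior_exp_cone]. Qed.

(** A point with no boundary point within e is moved to the boundary parallel to each axis; the
    three distances must be at least e, and [far_points_bounded] confines the point to a bounded
    set. *)
Lemma asymptotic_zero_level :
  asymptotic_to_boundary (@exp_cone R) (@zero_level R).
Proof.
split; first by move=> v [Dv _]; rewrite interior_exp_cone.
move=> e e0; have [a [b [a0 b0 Hab]]] := far_points_bounded e0.
pose L := `|ln a| + `|ln b|.
(* The summands bound |x|, y and z when kappa and z lie in [a, b]; the exponent 7 comes from y^2 =
   (1 + kappa) / (z^4 kappa^3). *)
pose M := b * (3 * L + 3 / 2 * L + b) + (1 + (1 + b) / a ^+ 7) + b.
have L0 : 0 <= L by rewrite addr_ge0.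
have M1 : 0 <= b * (3 * L + 3 / 2 * L + b) by rewrite mulr_ge0//; lra.
have M2 : 0 <= (1 + b) / a ^+ 7 by rewrite divr_ge0 ?exprn_ge0//; lra.
exists M => v Sv Mv; apply: contrapT => nq.
have far (q : 'cV[R]_3) : exp_cone q -> ~ exp_cone_int q -> e <= `|v - q|.
  move=> Kq Dq; rewrite leNgt; apply/negP => H; apply: nq; exists q.
  by have [? ?] := boundary_point Kq Dq.
have [Dv pv] := Sv; have [zv Hv] := Dv; have yv := exp_cone_int_Y Dv.
have hv := height_gt0 Dv.
(* Parallel to the x axis the boundary is reached at x = z ln (y / z). *)
have far1 : e <= Z v * height v.
  apply: le_trans (far (vec3 (Z v * ln (Y v / Z v)) (Y v) (Z v)) _ _) _.
  - right; exists (Z v * ln (Y v / Z v)), (Y v), (Z v); split=> //.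
    by rewrite mulrAC divff ?gt_eqF// mul1r lnK ?posrE ?divr_gt0.
  - case; rewrite !vec3E => _; rewrite mulrAC divff ?gt_eqF// mul1r.
    rewrite lnK ?posrE ?divr_gt0// mulrCA divff ?gt_eqF// mulr1.
    by rewrite ltxx.
  - have h0 : 0 <= Z v * height v by rewrite mulr_ge0// ltW.
    apply: norm_vec3_sub; rewrite ?subrr ?normr0//.
    have -> : X v - Z v * ln (Y v / Z v) = - (Z v * height v).
      by rewrite /height ln_div ?posrE//; field; rewrite gt_eqF.
    by rewrite normrN ger0_norm.
have Ee : Z v * expR (X v / Z v) = Y v * expR (- height v).
  rewrite expRN heightE//; field.
  by rewrite !gt_eqF// expR_gt0.
have far2 : e <= Y v - Z v * expR (X v / Z v).
  apply: le_trans (far (vec3 (X v) (Z v * expR (X v / Z v)) (Z v)) _ _) _.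
  - right; exists (X v), (Z v * expR (X v / Z v)), (Z v); split=> //.
    by rewrite mulrAC divff ?gt_eqF// mul1r.
  - by case; rewrite !vec3E ltxx.
  - have h0 : 0 <= Y v - Z v * expR (X v / Z v) by rewrite subr_ge0 ltW.
    apply: norm_vec3_sub; rewrite ?subrr ?normr0//.
    by rewrite ger0_norm.
(* Dropping z to 0 lands on the flat face of the cone only when x <= 0; this is the origin of the
   conditional hypothesis in [far_points_bounded]. *)
have far3 : X v <= 0 -> e <= Z v.
  move=> x0.
  apply: le_trans (far (vec3 (X v) (Y v) 0) _ _) _.
  - by left; exists (X v), (Y v); split=> //; exact: ltW.
  - by case; rewrite !vec3E ltxx.
  - apply: norm_vec3_sub; rewrite ?subrr ?subr0 ?normr0//; try exact: ltW.
    by rewrite gtr0_norm.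
move: Sv; rewrite zero_levelE => -[p qp Ev].
have [k0 z0] := (quadrantE p).1 qp.
have Eh : height v = theta (p 0 0) by rewrite -Ev height_sphere_param.
have EX : X v = - p 1 0 * (3 * ln (p 1 0) + 3 / 2 * ln (p 0 0) + p 0 0).
  by rewrite -Ev /sphere_param vec3E.
have EZ : Z v = p 1 0 by rewrite -Ev /sphere_param vec3E.
have lY : ln (Y v) = - 2 * ln (p 1 0) - 3 / 2 * ln (p 0 0) + ln (1 + p 0 0) / 2.
  by rewrite -Ev /sphere_param vec3E ln_sphere_Y.
move: k0 z0 Eh EX EZ lY {Ev qp}; move: (p 0 0) (p 1 0) => k z k0 z0 Eh EX EZ lY.
have EY : Y v ^+ 2 * z ^+ 4 * k ^+ 3 = 1 + k.
  have kp : 0 < 1 + k by lra.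
  apply: ln_inj; rewrite ?posrE ?mulr_gt0 ?exprn_gt0//.
  rewrite lnM ?posrE ?mulr_gt0 ?exprn_gt0// lnM ?posrE ?exprn_gt0//.
  by rewrite !lnXn// lY; field.
have y1 : e <= Y v.
  have := expR_gt0 (X v / Z v) => ?.
  have : 0 <= Z v * expR (X v / Z v) by rewrite mulr_ge0// ltW.
  lra.
(* The distance parallel to the y axis is y (1 - exp(- h)), which is at most y h. *)
have y2 : e <= Y v * theta k.
  rewrite -Eh; apply: (le_trans far2); rewrite Ee.
  have -> : Y v - Y v * expR (- height v) = Y v * (1 - expR (- height v)) by ring.
  by rewrite ler_pM2l//; have := expR_ge1Dx (- height v); lra.
have z2 : e <= z * theta k by rewrite -Eh -EZ.
have x2 : - z * (3 * ln z + 3 / 2 * ln k + k) <= 0 -> e <= z.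
  by rewrite -EX -EZ.
have [ak kb az zb] := Hab k z (Y v) k0 z0 yv EY y1 z2 y2 x2.
have lnb r : a <= r -> r <= b -> `|ln r| <= L.
  move=> ar rb; have r0 : 0 < r by exact: lt_le_trans ar.
  have l1 : ln a <= ln r by rewrite ler_ln ?posrE.
  have l2 : ln r <= ln b by rewrite ler_ln ?posrE.
  rewrite /L ler_norml; have := ler_norm (ln b); have := ler_norm (- ln a).
  by rewrite normrN => ? ?; have := normr_ge0 (ln a); have := normr_ge0 (ln b); lra.
have HX : `|X v| <= b * (3 * L + 3 / 2 * L + b).
  rewrite EX mulNr normrN normrM gtr0_norm//; apply: ler_pM => //; first exact: ltW.
  apply: (le_trans (ler_normD _ _)); apply: lerD; last by rewrite gtr0_norm.
  apply: (le_trans (ler_normD _ _)); apply: lerD; rewrite normrM gtr0_norm//.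
    by rewrite ler_pM2l// lnb.
  by rewrite ler_pM2l// lnb.
have HY : `|Y v| <= 1 + (1 + b) / a ^+ 7.
  rewrite gtr0_norm//; apply: (@le_1D_of_exp_le _ _ 2) => //; first exact: ltW.
  have -> : Y v ^+ 2 = (1 + k) / (z ^+ 4 * k ^+ 3).
    by rewrite -EY; field; rewrite !gt_eqF.
  rewrite ler_pM ?invr_ge0 ?mulr_ge0 ?exprn_ge0 ?(ltW z0) ?(ltW k0)//; try lra.
  rewrite lef_pV2 ?posrE ?mulr_gt0 ?exprn_gt0//.
  rewrite (_ : a ^+ 7 = a ^+ 4 * a ^+ 3); last by ring.
  by apply: ler_pM; rewrite ?exprn_ge0 ?lerXn2r ?nnegrE ?(ltW a0) ?(ltW z0) ?(ltW k0).
have HZ : `|Z v| <= b by rewrite EZ gtr0_norm.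
have : `|v| <= M.
  apply: norm_mx_le => [|i j]; first by rewrite /M; lra.
  rewrite (ord1 j); elim/ord3_ind: i; rewrite /M; lra.
by rewrite leNgt Mv.
Qed.

End asymptotics.

Section main.
Context {R : realType}.

Lemma level_setE (F : 'cV[R]_3 -> R) : canonical_potential (@exp_cone R) F ->
  level_set (@exp_cone R) F 0 = @zero_level R.
Proof.
move=> HF; have E := canonical_potential_exp_coneE HF.
rewrite /level_set interior_exp_cone.
by apply/seteqP; split=> v [Dv pv]; split=> //; rewrite -pv E.
Qed.

Lemma connected_setT_cV (n : nat) : connected [set: 'cV[R]_n].
Proof.
have -> : [set: 'cV[R]_n] =
    \bigcup_v ((fun t : R => t *: (v : 'cV[R]_n)) @` `[0, 1]).
  apply/esym; rewrite -subTset => v _; exists v => //; exists 1; last by rewrite scale1r.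
  by rewrite /= in_itv/= ler01 lexx.
apply: bigcup_connected => [|v _].
  by exists 0 => v _; exists 0; rewrite ?scale0r//= in_itv/= lexx ler01.
apply: connected_continuous_connected.
  exact: segment_connected.
apply: continuous_subspaceT => t.
by apply: cvgZr_tmp; exact: cvg_id.
Qed.

Lemma affine_sphere_zero_level :
  @complete_hyperbolic_affine_sphere R 2 (@exp_cone R) (@zero_level R).
Proof.
exists setT, (@chart R), (@affine_normal R), (@affine_metric R); split.
- by split; [exact: openT|exact: connected_setT_cV|exists 0].
- split; [exact: immersion_chart| |exact: image_chart].
  by move=> p q _ _; exact: chart_inj.
- split; [exact: blaschke_normal_chart| |exact: complete_affine_metric].
  by move=> p _; exact: affine_normal_proportional.
- split; [exact: zero_level_interior|exact: separates_zero_level|].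
  exact: asymptotic_zero_level.
Qed.

End main.

Theorem mainTheorem2 (R : realType) :
  (exists F : 'cV[R]_3 -> R, canonical_potential (@exp_cone R) F) /\
  forall F : 'cV[R]_3 -> R, canonical_potential (@exp_cone R) F ->
    [/\ @complete_hyperbolic_affine_sphere R 2 (@exp_cone R)
          (level_set (@exp_cone R) F 0),
        immersion_on (@quadrant R) (@sphere_param R)
      & level_set (@exp_cone R) F 0 = @sphere_param R @` @quadrant R].
Proof.
split; first by exists potential; exact: canonical_potential_exp_cone.
move=> F HF; rewrite (level_setE HF); split.
- exact: affine_sphere_zero_level.
- exact: immersion_sphere_param.
- exact: zero_levelE.
Qed.
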